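(* Let $\mathbb{K}$ be a field, let $N\geq1$, and let $I$ be a homogeneous ideal of $R=\mathbb{K}[x_0,\ldots,x_N]$ with $(0)\neq I\subsetneq R$. (a) We have $$1\leq\rho_{int}(I)=\max\Big\{\big\{\tfrac{m}{r}: \overline{I^m}\not\subseteq I^r\big\}\cup\{1\}\Big\}$$ (in particular the maximum exists). (b) If $I=\overline{I}$ and $N>1$, then $\rho_{int}(I)<N$. (c) If $I^{(m)}=\overline{I^{(m)}}$ for all $m\geq1$ (as for example is the case for $I=I(Z)$ for a fat point subscheme $Z\subset\mathbb{P}^N$), then $\rho_{int}(I)\leq\rho(I)$. (d) If $I^{(m)}=\overline{I^m}$ for all $m\geq1$, then $\rho_{int}(I)=\rho(I)$.
   Context: $\overline{J}$ denotes the integral closure of an ideal $J\subseteq R$: the set of $c\in R$ satisfying $c^n+a_1c^{n-1}+\cdots+a_n=0$ for some $n\geq 1$ and some $a_j\in J^j$. For $m\geq 1$ the $m$-th symbolic power of $I$ is $I^{(m)}=R\cap\bigcap_{P\in \mathrm{Ass}(R/I)} I^mR_P$, where the intersections take place in the fraction field of $R$. With $m,r$ denoting positive integers: the resurgence is $\rho(I)=\sup\{\frac{m}{r} : I^{(m)}\not\subseteq I^r\}$, and the integral closure resurgence is $\rho_{int}(I)=\sup\{\frac{m}{r} : \overline{I^m}\not\subseteq I^r\}$. Fat points: given distinct points $p_1,\ldots,p_s\in\mathbb{P}^N$ and nonnegative integers $m_1,\ldots,m_s$, not all $0$, the fat point scheme $Z=m_1p_1+\cdots+m_sp_s$ is the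 scheme defined by the ideal $I(Z)=\bigcap_{i=1}^s I(p_i)^{m_i}\subseteq R$, where $I(p_i)$ is the ideal generated by all homogeneous polynomials vanishing at $p_i$. *)

(* Defs.v *)
From mathcomp Require Import all_boot all_order all_algebra.
From mathcomp Require Import fraction ring_quotient.
From mathcomp Require Export mpoly.
From mathcomp Require Import boolp classical_sets reals constructive_ereal ereal.

Set Implicit Arguments.
Unset Strict Implicit.
Unset Printing Implicit Defensive.

Import Order.TTheory GRing.Theory Num.Theory.

Local Open Scope classical_set_scope.
Local Open Scope ring_scope.

Definition ideal_gen (A : comNzRingType) (S : set A) : set A :=
  [set x | exists (n : nat) (c g : 'I_n -> A),
     (forall i, S (g i)) /\ x = \sum_(i < n) c i * g i].

(* [ideal_pow I 0] is the whole ring, the empty product being 1. *)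
Definition ideal_pow (A : comNzRingType) (I : set A) (r : nat) : set A :=
  ideal_gen [set x | exists g : 'I_r -> A,
     (forall i, I (g i)) /\ x = \prod_(i < r) g i].

Definition int_closure (A : comNzRingType) (J : set A) : set A :=
  [set c | exists (n : nat) (a : nat -> A),
     [/\ (0 < n)%N,
         (forall j, (1 <= j <= n)%N -> ideal_pow J j (a j)) &
         c ^+ n + \sum_(1 <= j < n.+1) a j * c ^+ (n - j) = 0]].

(* P is the annihilator (I : f) of the class of f in A/I;
   [idealr_closed] already contains 1 \notin P. *)
Definition ass_primes (A : comNzRingType) (I : set A) : set (set A) :=
  [set P | [/\ idealr_closed (mem P), prime_idealr_closed (mem P) &
     exists f : A, P = [set g | I (g * f)]]].

(* The ideal J A_P of A_P, inside the fraction field of A. *)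
Definition loc_ideal (A : idomainType) (J P : set A) : set {fraction A} :=
  [set z | exists a s : A, [/\ J a, ~ P s & z = tofrac a / tofrac s]].

Definition symb_pow (A : idomainType) (I : set A) (m : nat) : set A :=
  [set f | (\bigcap_(P in ass_primes I) loc_ideal (ideal_pow I m) P) (tofrac f)].

Definition noncontainment_ratios (R : realType) (A : comNzRingType)
    (J : nat -> set A) (I : set A) : set (\bar R) :=
  [set q | exists m r : nat,
     [/\ (0 < m)%N, (0 < r)%N, ~ (J m `<=` ideal_pow I r) &
         q = (m%:R / r%:R)%:E]].
Arguments noncontainment_ratios R {A} J I _.

(* The suprema are taken in the extended reals, so that an unbounded set of
   ratios has supremum +oo. *)
Definition resurgence (R : realType) (A : idomainType) (I : set A) : \bar R :=
  ereal_sup (noncontainment_ratios R (symb_pow I) I).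

Definition int_ratios (R : realType) (A : comNzRingType) (I : set A) :
    set (\bar R) :=
  noncontainment_ratios R (fun m => int_closure (ideal_pow I m)) I.
Arguments int_ratios R {A} I _.

Definition int_resurgence (R : realType) (A : comNzRingType) (I : set A) :
    \bar R :=
  ereal_sup (int_ratios R I).

Definition is_maximum d (T : porderType d) (S : set T) (x : T) : Prop :=
  S x /\ ubound S x.

(* As [idealr_closed] contains 1 \notin I, the ideal is proper. *)
Definition proper_homog_ideal (K : fieldType) (n : nat)
    (I : set {mpoly K[n]}) : Prop :=
  idealr_closed (mem I) /\
  forall (f : {mpoly K[n]}) (d : nat), I f -> I (pihomog mdeg d f).

(* Points of P^N are represented by nonzero vectors of homogeneous
   coordinates in K^(N+1). *)
Definition distinct_points (K : fieldType) (N s : nat)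
    (p : 'I_s -> 'rV[K]_N.+1) : Prop :=
  (forall i, p i != 0) /\
  (forall i j, i != j -> forall c : K, p i != c *: p j).

Definition point_ideal (K : fieldType) (N : nat) (p : 'rV[K]_N.+1) :
    set {mpoly K[N.+1]} :=
  ideal_gen [set f | (exists d : nat, f \is d.-homog) /\ f.@[p ord0] = 0].

Definition fat_point_ideal (K : fieldType) (N s : nat)
    (p : 'I_s -> 'rV[K]_N.+1) (mult : 'I_s -> nat) : set {mpoly K[N.+1]} :=
  \bigcap_(i in [set: 'I_s]) ideal_pow (point_ideal (p i)) (mult i).

(* Main.v *)
(* The heart of the matter is the Briancon-Skoda theorem: for a homogeneous
   ideal I in n variables over any field, the integral closure of I^m lies in
   I^r as soon as m >= r + n - 1.  It makes m < r + N whenever m/r is one of the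
   ratios, so that only finitely many ratios exceed any number greater than 1,
   and for m >= N r it forces r = 1.

   Over an algebraically closed field of characteristic p it is proved at the
   origin by a tight closure argument.  Up to a unit at the origin, I has a
   reduction J with n generators; if c is integral over I^m, some w <> 0
   satisfies w c^q in J^(mq) for all q = p^e, up to a unit, and J^(mq) lies in
   the Frobenius power (J^r)^[q] by the pigeonhole principle.  Taking q-th roots
   of the coordinates of w with respect to the monomials with exponents below q
   gives v c in J^r with v(0) <> 0.

   If c is not in I^r for some field K, homogeneity provides d and a linear
   functional on polynomials modulo degree d that kills I^r but not c.  All the
   data live over a finitely generated subring of K, which has a morphism to an
   algebraically closed field of positive characteristic that keeps the value of
   the functional at c nonzero, a contradiction.

   For fat points, an associated prime of I is one of the point ideals P_i, I^m
   agrees with P_i^(m m_i) locally at P_i, and P_i^k consists of the polynomials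
   vanishing to order at least k along a line, which is a valuation ideal. *)

Require Import Defs.
From mathcomp Require Import all_boot all_order all_algebra.
From mathcomp Require Import boolp classical_sets reals constructive_ereal ereal.
From mathcomp Require Import fraction ring_quotient closed_field zify.

Set Implicit Arguments.
Unset Strict Implicit.
Unset Printing Implicit Defensive.

Import Order.TTheory GRing.Theory Num.Theory.

Local Open Scope classical_set_scope.
Local Open Scope ring_scope.

(** * Ideals and their powers *)

Section Ideals.
Variable A : comNzRingType.
Implicit Types (I J S T : set A) (x y u : A).

Definition is_ideal T :=
  [/\ T 0, forall x y, T x -> T y -> T (x + y) & forall a x, T x -> T (a * x)].

Lemma is_ideal0 T : is_ideal T -> T 0.
Proof. by case. Qed.

Lemma is_ideal_sum T (iT : is_ideal T) (X : Type) (s : seq X) (P : pred X) F :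
  (forall i, P i -> T (F i)) -> T (\sum_(i <- s | P i) F i).
Proof. by case: iT => T0 TD _ TF; apply: (big_ind T). Qed.

Lemma is_idealN T x : is_ideal T -> T x -> T (- x).
Proof. by case=> _ _ TM Tx; rewrite -mulN1r; apply: TM. Qed.

Lemma is_idealMr T x a : is_ideal T -> T x -> T (x * a).
Proof. by case=> _ _ TM Tx; rewrite mulrC; apply: TM. Qed.

Lemma is_ideal_colon T u : is_ideal T -> is_ideal [set x | T (u * x)].
Proof.
case=> T0 TD TM; split=> [|x y Tx Ty|a x Tx] /=; first by rewrite mulr0.
  by rewrite mulrDr; apply: TD.
by rewrite mulrCA; apply: TM.
Qed.

Lemma ideal_gen_ideal S : is_ideal (ideal_gen S).
Proof.
split=> [|x y [n [c [g [Sg ->]]]] [m [d [h [Sh ->]]]]|a x [n [c [g [Sg ->]]]]].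
- by exists 0%N, (fun=> 0), (fun=> 0); split=> [[]//|]; rewrite big_ord0.
- exists (n + m)%N, (fun i => match split i with inl j => c j | inr j => d j end),
    (fun i => match split i with inl j => g j | inr j => h j end).
  split=> [i|]; first by case: (split i).
  rewrite big_split_ord /=; congr (_ + _); apply: eq_bigr => i _.
    by have /= -> := unsplitK (inl i).
  by have /= -> := unsplitK (inr i).
- exists n, (fun i => a * c i), g; split=> //.
  by rewrite mulr_sumr; apply: eq_bigr => i _; rewrite mulrA.
Qed.

Lemma sub_ideal_gen S : S `<=` ideal_gen S.
Proof.
move=> x Sx; exists 1%N, (fun=> 1), (fun=> x); split=> //.
by rewrite big_ord1 mul1r.
Qed.

Lemma ideal_gen_min S T : is_ideal T -> S `<=` T -> ideal_gen S `<=` T.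
Proof.
move=> iT ST x [n [c [g [Sg ->]]]]; apply: is_ideal_sum => // i _.
by case: iT => _ _ TM; apply: TM; apply: ST.
Qed.

Lemma ideal_pow_ideal I r : is_ideal (ideal_pow I r).
Proof. exact: ideal_gen_ideal. Qed.

Lemma ideal_pow_prod I r (g : 'I_r -> A) :
  (forall i, I (g i)) -> ideal_pow I r (\prod_(i < r) g i).
Proof. by move=> Ig; apply: sub_ideal_gen; exists g. Qed.

Lemma ideal_pow_min I r T : is_ideal T ->
  (forall g : 'I_r -> A, (forall i, I (g i)) -> T (\prod_(i < r) g i)) ->
  ideal_pow I r `<=` T.
Proof. by move=> iT TP; apply: ideal_gen_min => // x [g [Ig ->]]; apply: TP. Qed.

Lemma ideal_pow0 I x : ideal_pow I 0 x.
Proof.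
rewrite -[x]mulr1; case: (ideal_pow_ideal I 0) => _ _; apply.
have := @ideal_pow_prod I 0 (fun=> 1); rewrite big_ord0.
by apply; case.
Qed.

Lemma ideal_powM I a b x y :
  ideal_pow I a x -> ideal_pow I b y -> ideal_pow I (a + b) (x * y).
Proof.
move=> Ix Iy; move: x Ix; apply: ideal_pow_min => [|g Ig].
  have [P0 PD PM] := ideal_pow_ideal I (a + b).
  split=> [|x z Hx Hz|u x Hx]; first by rewrite mul0r.
    by rewrite mulrDl; apply: PD.
  by rewrite -mulrA; apply: PM.
move: y Iy; apply: (ideal_pow_min (is_ideal_colon _ (ideal_pow_ideal _ _))).
move=> h Ih /=.
have := @ideal_pow_prod I (a + b)
  (fun i => match split i with inl j => g j | inr j => h j end).
rewrite big_split_ord /=.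
under eq_bigr => i _ do rewrite (unsplitK (inl i)).
under [X in _ * X]eq_bigr => i _ do rewrite (unsplitK (inr i)).
by apply=> i; case: (split i).
Qed.

Lemma ideal_pow1 I x : I x -> ideal_pow I 1 x.
Proof. by move=> Ix; rewrite -[x](big_ord1 *%R (fun=> x)); apply: ideal_pow_prod. Qed.

Lemma ideal_powS I r x y : I x -> ideal_pow I r y -> ideal_pow I r.+1 (x * y).
Proof. by move=> /ideal_pow1; apply: ideal_powM. Qed.

Lemma ideal_powS_min I r T : is_ideal T ->
  (forall x y, I x -> ideal_pow I r y -> T (x * y)) -> ideal_pow I r.+1 `<=` T.
Proof.
move=> iT TP; apply: ideal_pow_min => // g Ig; rewrite big_ord_recl.
by apply: TP => //; apply: ideal_pow_prod.
Qed.

Lemma ideal_powX I r x : I x -> ideal_pow I r (x ^+ r).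
Proof.
move=> Ix; have := @ideal_pow_prod I r (fun=> x) (fun=> Ix).
by rewrite prodr_const card_ord.
Qed.

Lemma ideal_pow_sub I a b : (b <= a)%N -> ideal_pow I a `<=` ideal_pow I b.
Proof.
move=> /subnK <-; elim: (a - b)%N => // c IH; rewrite addSn.
apply: ideal_powS_min => [|x y _ /IH]; first exact: ideal_pow_ideal.
by case: (ideal_pow_ideal I b) => _ _; apply.
Qed.

Lemma ideal_pow_subM I J k r :
  I `<=` ideal_pow J k -> ideal_pow I r `<=` ideal_pow J (k * r).
Proof.
move=> IJ; elim: r => [|r IH]; first by move=> x _; rewrite muln0; apply: ideal_pow0.
apply: ideal_powS_min => [|x y /IJ Ix /IH Iy]; first exact: ideal_pow_ideal.
by rewrite mulnS; apply: ideal_powM.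
Qed.

Lemma ideal_powS_set I J r : I `<=` J -> ideal_pow I r `<=` ideal_pow J r.
Proof.
by move=> IJ; have := @ideal_pow_subM I J 1 r; rewrite mul1n; apply=> x /IJ /ideal_pow1.
Qed.

Lemma ideal_pow1_sub I : is_ideal I -> ideal_pow I 1 `<=` I.
Proof. by move=> iI; apply: ideal_pow_min => // g Ig; rewrite big_ord1. Qed.

Lemma ideal_pow_gen S r : ideal_pow (ideal_gen S) r `<=` ideal_pow S r.
Proof.
have := @ideal_pow_subM (ideal_gen S) S 1 r; rewrite mul1n; apply.
by apply: ideal_gen_min => [|x]; [apply: ideal_pow_ideal | apply: ideal_pow1].
Qed.

Lemma int_closure_sub (J J' : set A) :
  J `<=` J' -> int_closure J `<=` int_closure J'.
Proof.
move=> sJ c [n [a [n0 aJ e]]]; exists n, a; split=> // j /aJ.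
exact: ideal_powS_set.
Qed.

Lemma sub_int_closure J : J `<=` int_closure J.
Proof.
move=> x Jx; exists 1%N, (fun=> - x); split=> // [j|].
  rewrite -eqn_leq => /eqP <-; apply: is_idealN (ideal_pow1 Jx).
  exact: ideal_pow_ideal.
by rewrite big_nat1 expr1 expr0 mulr1 subrr.
Qed.

Lemma int_closure_conductor (J : set A) c : int_closure J c ->
  exists n, forall k x, ideal_pow J n x -> ideal_pow J k (x * c ^+ k).
Proof.
move=> [n [a [_ aJ /eqP]]]; rewrite addr_eq0 => /eqP cn.
exists n => k x Jx; elim/ltn_ind: k => k IH.
have iJ := ideal_pow_ideal J k; have [kn|nk] := ltnP k n.
  by apply: is_idealMr => //; apply: ideal_pow_sub Jx; apply: ltnW.
rewrite -(subnKC nk) exprD cn mulNr mulrN subnKC //; apply: is_idealN => //.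
rewrite mulr_suml mulr_sumr big_seq; apply: is_ideal_sum => // j.
rewrite mem_index_iota => jn.
rewrite -mulrA -exprD mulrCA (_ : k = j + (k - j))%N; last by lia.
apply: ideal_powM; first exact: aJ.
rewrite (_ : n - j + (j + (k - j) - n) = k - j)%N; last by lia.
by apply: IH; lia.
Qed.

End Ideals.

(** * Specialization to positive characteristic *)

Section Specialization.
Variable K : fieldType.

(* The condition on kernels says that e' factors through the subring e(B) of K. *)
Definition specializable (B : comNzRingType) (e : {rmorphism B -> K}) : Prop :=
  forall g, e g != 0 ->
  exists (F : closedFieldType) (p : nat) (e' : {rmorphism B -> F}),
    [/\ p \in [pchar F], forall b, e b = 0 -> e' b = 0 & e' g != 0].

Lemma specializable_int :
  exists (B : comNzRingType) (e : {rmorphism B -> K}), specializable e.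
Proof.
exists int, (intmul 1 : int -> K) => g.
have Fp_closed (p : nat) : prime p -> exists F : closedFieldType, p \in [pchar F].
  move=> pp; have [F [f _]] := countable_algebraic_closure 'F_p.
  by exists F; rewrite (fmorph_pchar f) pchar_Fp.
have intr_eq0 (F : fieldType) (z : int) :
    ((z%:~R : F) == 0) = (`|z|%N%:R == 0 :> F).
  by case: z => m; rewrite ?NegzE ?rmorphN ?oppr_eq0.
have [[p pK]|noK] := pselect (exists p, p \in [pchar K]) => g0.
  have [F pF] := Fp_closed p (pcharf_prime pK).
  exists F, p, (intmul 1 : int -> F); split=> // [b /eqP|]; last first.
    by move: g0; rewrite !intr_eq0 -(dvdn_pcharf pF) -(dvdn_pcharf pK).
  by rewrite intr_eq0 -(dvdn_pcharf pK) (dvdn_pcharf pF) -intr_eq0 => /eqP.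
have [p gp pp] := prime_above `|g|%N; have [F pF] := Fp_closed p pp.
exists F, p, (intmul 1 : int -> F); split=> // [b /eqP|].
  rewrite intr_eq0; have /pcharf0P -> : [pchar K] =i pred0.
    by move=> q; apply/negP => qK; apply: noK; exists q.
  by rewrite absz_eq0 => /eqP ->.
rewrite intr_eq0 -(dvdn_pcharf pF) gtnNdvd // absz_gt0.
by apply: contraNneq g0 => ->.
Qed.

Variables (B : comNzRingType) (e : {rmorphism B -> K}) (z : K).

Lemma comm_horner (F : fieldType) (f : {rmorphism B -> F}) (w : F) :
  commr_rmorph f w.
Proof. by move=> b; apply: mulrC. Qed.

Definition eval_ext (F : fieldType) (f : {rmorphism B -> F}) (w : F) :
  {rmorphism {poly B} -> F} := horner_morph (comm_horner f w).

Local Notation ev := (eval_ext e z).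

Lemma eval_extE (F : fieldType) (f : {rmorphism B -> F}) (w : F) p :
  eval_ext f w p = (map_poly f p).[w].
Proof. by []. Qed.

Lemma map_poly_trim (p : {poly B}) : exists q : {poly B},
  map_poly e q = map_poly e p /\ size q = size (map_poly e p).
Proof.
exists (take_poly (size (map_poly e p)) p).
have E : map_poly e (take_poly (size (map_poly e p)) p) = map_poly e p.
  apply/polyP => i; rewrite !coef_map coef_take_poly.
  case: ltnP => // le; rewrite -(coef_map e p) nth_default //; exact: raddf0.
split=> //; apply/eqP; rewrite eqn_leq size_take_poly /=.
have : (size (map_poly e (take_poly (size (map_poly e p)) p)) <=
  size (take_poly (size (map_poly e p)) p))%N by apply: size_poly.
by rewrite E.
Qed.

Lemma map_poly_ker (F : fieldType) (f : {rmorphism B -> F}) (p : {poly B}) :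
  (forall b, e b = 0 -> f b = 0) -> map_poly e p = 0 -> map_poly f p = 0.
Proof.
move=> ker p0; apply/polyP => i; rewrite coef_map coef0; apply: ker.
by rewrite -coef_map p0 coef0.
Qed.

Lemma eval_ext_trans : specializable e ->
  (forall p, ev p = 0 -> map_poly e p = 0) -> specializable ev.
Proof.
move=> spec inj g gn0.
have : map_poly e g != 0.
  by apply: contraNneq gn0 => g0; rewrite eval_extE g0 horner0.
rewrite -lead_coef_eq0 lead_coefE coef_map => /spec[F [p [e' [pF ker en0]]]].
have : map_poly e' g != 0.
  apply: contraNneq en0 => g0; rewrite -coef_map g0 coef0 //.
move=> /closed_nonrootP[w gw]; exists F, p, (eval_ext e' w); split=> //.
by move=> b /inj /(map_poly_ker ker) b0; rewrite eval_extE b0 horner0.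
Qed.

Section Algebraic.
Variable h : {poly B}.
Hypotheses (hz : ev h = 0) (h0 : e (lead_coef h) != 0).
Hypothesis hmin : forall p, ev p = 0 -> (size p < size h)%N -> map_poly e p = 0.

Import Pdiv.Ring Pdiv.ComRing.

Lemma eval_ext_kerP (p : {poly B}) : ev p = 0 ->
  exists k q r, lead_coef h ^+ k *: p = q * h + r /\ map_poly e r = 0.
Proof.
move=> pz; exists (rscalp p h), (rdivp p h), (rmodp p h).
have E := rdivp_eq h p; split=> //; apply: hmin.
  have /(congr1 ev) := E; rewrite -mul_polyC !(rmorphM, rmorphD) /= hz pz.
  by rewrite !mulr0 add0r => <-.
by apply: ltn_rmodpN0; apply: contraNneq h0 => ->; rewrite lead_coef0 rmorph0.
Qed.

Lemma size_minpoly_gt1 : (1 < size h)%N.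
Proof.
rewrite ltnNge; apply/negP => /size1_polyC hC.
move: hz h0; rewrite hC lead_coefC eval_extE map_polyC hornerC => -> /eqP //.
Qed.

Lemma eval_ext_unit (g : {poly B}) : ev g != 0 ->
  exists u b, e b != 0 /\ ev (u * g) = e b.
Proof.
move: {2}_.+1 (ltnSn (size g)) => s; elim: s g => // s IH g gs gn0.
have [q [qg sq]] := map_poly_trim g.
have evq : ev q = ev g by rewrite !eval_extE qg.
have qn0 : ev q != 0 by rewrite evq.
have {gs} qs : (size q < s.+1)%N by rewrite sq (leq_ltn_trans (size_poly _ _)).
suff [u [b [b0 E]]] : exists u b, e b != 0 /\ ev (u * q) = e b.
  by exists u, b; rewrite rmorphM -evq -rmorphM.
have lq0 : e (lead_coef q) != 0.
  rewrite lead_coefE sq -coef_map qg -lead_coefE lead_coef_eq0.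
  by apply: contraNneq gn0 => g0; rewrite eval_extE g0 horner0.
have [q1|q1] := leqP (size q) 1.
  exists 1, q`_0; move: qn0; rewrite mul1r (size1_polyC q1).
  by rewrite eval_extE map_polyC /= hornerC coefC eqxx.
have nz (f : {poly B}) : e (lead_coef f) != 0 -> f != 0.
  by apply: contraNneq => ->; rewrite lead_coef0 rmorph0.
have [hq|qh] := leqP (size h) (size q).
  have E := rdivp_eq h q; have /(congr1 ev) := E.
  rewrite -mul_polyC rmorphM rmorphD rmorphM hz mulr0 add0r => Er.
  have sr : (size (rmodp q h) < s)%N.
    exact: leq_trans (ltn_rmodpN0 _ (nz _ h0)) (leq_trans hq qs).
  have rn0 : ev (rmodp q h) != 0.
    rewrite -Er mulf_neq0 // eval_extE map_polyC hornerC /=.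
    by rewrite rmorphXn expf_neq0.
  have [u [b [b0 Eb]]] := IH _ sr rn0.
  exists (u * (lead_coef h ^+ rscalp q h)%:P), b; split=> //.
  by rewrite -mulrA rmorphM rmorphM Er -rmorphM.
have E := rdivp_eq q h; have /(congr1 ev) := E.
rewrite -mul_polyC rmorphM hz mulr0 rmorphD rmorphM.
move=> /eqP; rewrite eq_sym addr_eq0 => /eqP Er.
have sr := ltn_rmodpN0 h (nz _ lq0).
have [r0|rn0] := eqVneq (ev (rmodp h q)) 0; last first.
  have [u [b [b0 Eb]]] := IH _ (leq_trans sr qs) rn0.
  exists (- u * rdivp h q), b; split=> //.
  by rewrite -mulrA rmorphM rmorphN (rmorphM _ (rdivp h q)) Er mulrNN -rmorphM.
have re0 : map_poly e (rmodp h q) = 0 by apply: hmin => //; apply: ltn_trans sr qh.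
have d0 : ev (rdivp h q) = 0.
  by move: Er; rewrite r0 oppr0 => /eqP; rewrite mulf_eq0 (negPf qn0) orbF => /eqP.
have /(congr1 (map_poly e)) := E.
rewrite map_polyZ rmorphD rmorphM /= re0 addr0 => Ee.
have le0 : e (lead_coef q ^+ rscalp h q) != 0 by rewrite rmorphXn expf_neq0.
have hn0 : map_poly e h != 0.
  apply: contraNneq h0 => h0'; by rewrite lead_coefE -coef_map h0' coef0.
have [d [de sd]] := map_poly_trim (rdivp h q).
have den0 : map_poly e d != 0.
  rewrite de; apply: contraNneq hn0 => d0'; move: Ee; rewrite d0' mul0r.
  by move=> /eqP; rewrite scaler_eq0 (negPf le0).
case/eqP: (den0); apply: hmin; first by rewrite eval_extE de.
have qe0 : map_poly e q != 0 
  by apply: contraNneq lq0 => q0; rewrite lead_coefE -coef_map q0 coef0.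
have : size (e (lead_coef q ^+ rscalp h q) *: map_poly e h) =
  size (map_poly e d * map_poly e q) by rewrite Ee de.
have sd2 : size (map_poly e d) = size d by rewrite de -sd.
have sq2 : size (map_poly e q) = size q by rewrite qg -sq.
have szM (x y : {poly K}) : x != 0 -> y != 0 -> size (x * y) = (size x + size y).-1.
  exact: size_mul.
rewrite size_scale // szM // sd2 sq2.
have le : (size (map_poly e h) <= size h)%N by apply: size_poly.
move=> Es; apply: leq_trans le; rewrite [X in (_ <= X)%N]Es.
by case: (size q) q1 => [|[|k]] // _; rewrite !addnS /= ltnS leq_addr.
Qed.

Lemma eval_ext_alg : specializable e -> specializable ev.
Proof.
move=> spec g gn0; have [u [b [b0 Eb]]] := eval_ext_unit gn0.
have : e (lead_coef h * b) != 0 by rewrite rmorphM mulf_neq0.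
move=> /spec[F [p [e' [pF ker]]]]; rewrite rmorphM mulf_eq0 negb_or => /andP[lh0 eb0].
have : size (map_poly e' h) != 1.
  rewrite size_poly_eq //; have := size_minpoly_gt1; by case: (size h) => [|[]].
move=> /closed_rootP[w /eqP hw].
have kerw f : ev f = 0 -> eval_ext e' w f = 0.
  move=> /eval_ext_kerP[k [q [r [E r0]]]].
  have /(congr1 (eval_ext e' w)) := E.
  rewrite -mul_polyC !(rmorphM, rmorphD) /= !eval_extE hw (map_poly_ker ker r0).
  rewrite mulr0 horner0 addr0 map_polyC hornerC /= rmorphXn => /eqP.
  by rewrite mulf_eq0 expf_eq0 (negPf lh0) andbF => /eqP.
exists F, p, (eval_ext e' w); split=> //.
have : ev (u * g - b%:P) = 0.
  by rewrite rmorphB Eb eval_extE map_polyC hornerC subrr.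
move=> /kerw; rewrite rmorphB rmorphM => /eqP; rewrite subr_eq0 => /eqP E.
apply: contraNneq eb0 => g0; move: E; rewrite g0 mulr0.
by rewrite eval_extE map_polyC hornerC => <-.
Qed.

End Algebraic.

Lemma specializable_ext : specializable e -> specializable ev.
Proof.
move=> spec.
have [H|] := pselect (exists f, ev f = 0 /\ map_poly e f != 0); last first.
  move=> nH; apply: eval_ext_trans => // p pz; apply/eqP; apply: contra_notT nH.
  by move=> pn0; exists p.
have exn : exists n, `[< exists f, [/\ ev f = 0, map_poly e f != 0 & size f = n] >].
  by case: H => f [fz f0]; exists (size f); apply/asboolP; exists f.
case: (ex_minnP exn) => n /asboolP[f [fz f0 fn]] nmin.
have hmin p : ev p = 0 -> (size p < size f)%N -> map_poly e p = 0.
  move=> pz; rewrite fn; apply: contraTeq => p0; rewrite -leqNgt; apply: nmin.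
  by apply/asboolP; exists p.
apply: (eval_ext_alg fz) => //.
have [q [qf sq]] := map_poly_trim f.
have : (n <= size q)%N.
  by apply: nmin; apply/asboolP; exists q; rewrite eval_extE qf.
rewrite sq -fn => sf; have {}sf : size (map_poly e f) = size f.
  by apply/eqP; rewrite eqn_leq size_poly.
by rewrite lead_coefE -sf -coef_map -lead_coefE lead_coef_eq0.
Qed.

End Specialization.

Lemma specializable_seq (K : fieldType) (s : seq K) :
  exists (B : comNzRingType) (e : {rmorphism B -> K}),
    specializable e /\ forall x, x \in s -> exists b, e b = x.
Proof.
elim: s => [|z s [B [e [spec cov]]]].
  by have [B [e spec]] := specializable_int K; exists B, e.
exists {poly B}, (eval_ext e z); split; first exact: specializable_ext.
move=> x; rewrite inE => /orP[/eqP ->|/cov[b <-]].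
  by exists 'X; rewrite eval_extE map_polyX hornerX.
by exists b%:P; rewrite eval_extE map_polyC hornerC.
Qed.

(** * Frobenius powers *)

Section Order.
Variables (n : nat) (R : comNzRingType).
Implicit Types (x y u w : {mpoly R[n]}).

Definition ord_ge (d : nat) : set {mpoly R[n]} :=
  [set x | forall m : 'X_{1..n}, (mdeg m < d)%N -> x@_m = 0].

Lemma ord_geM a b x y : ord_ge a x -> ord_ge b y -> ord_ge (a + b) (x * y).
Proof.
move=> xa yb m mab; rewrite mcoeffM big1 // => -[k1 k2] /= /eqP /(congr1 (@mdeg n)).
rewrite mdegD => mE.
have [k1a|ak1] := ltnP (mdeg k1) a; first by rewrite xa ?mul0r.
by rewrite yb ?mulr0 //; lia.
Qed.

Lemma ord_ge0 x : ord_ge 0 x.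
Proof. by []. Qed.

Lemma ord_ge_ideal d : is_ideal (ord_ge d).
Proof.
split=> [m _|x y xd yd m md|a x xd]; first by rewrite mcoeff0.
  by rewrite mcoeffD xd // yd // addr0.
by have := ord_geM (ord_ge0 a) xd.
Qed.

Lemma ord_geX d x k : ord_ge d x -> ord_ge (d * k) (x ^+ k).
Proof.
move=> xd; elim: k => [|k IH]; first by rewrite muln0.
by rewrite mulnS exprS; apply: ord_geM.
Qed.

Lemma ord_ge1P x : ord_ge 1 x <-> x@_0%MM = 0.
Proof.
split=> [|x0 m]; first by apply; rewrite mdeg0.
by rewrite ltnS leqn0 mdeg_eq0 => /eqP ->.
Qed.

Lemma mcoeff_mul_ord d u w m :
  ord_ge d w -> mdeg m = d -> (u * w)@_m = u@_0%MM * w@_m.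
Proof.
move=> wd md; rewrite -{1}[u](subrK (u@_0%MM)%:MP) mulrDl mcoeffD mcoeffCM.
have u1 : ord_ge 1 (u - (u@_0%MM)%:MP).
  by apply/ord_ge1P; rewrite mcoeffB mcoeffC eqxx mulr1 subrr.
by rewrite (ord_geM u1 wd) ?add0r // md.
Qed.

Lemma mlast_ord w : ord_ge (mdeg (mlast w)) w.
Proof.
move=> m mw; apply: mcoeff_lt_mlast; exact: lt_mdeg_ltmc.
Qed.

Lemma mcoeff_mlast w : w != 0 -> w@_(mlast w) != 0.
Proof. by move=> w0; rewrite -mcoeff_msupp mlast_supp. Qed.

Lemma mcoeff_MX_nle (x : {mpoly R[n]}) m k : ~~ (m <= k)%MM -> (x * 'X_[m])@_k = 0.
Proof.
move=> mk; apply: memN_msupp_eq0; rewrite (perm_mem (msuppMX _ _)).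
by apply: contra mk => /mapP[m' _ ->]; apply: lem_addr.
Qed.

End Order.

Lemma pnat_pcharX (R : comNzRingType) p e : p \in [pchar R] -> [pchar R].-nat (p ^ e)%N.
Proof. by move=> pR; rewrite pnatX pnatE ?pR // (pcharf_prime pR). Qed.

Lemma pchar_mpoly (R : comNzRingType) n p :
  p \in [pchar R] -> p \in [pchar {mpoly R[n]}].
Proof.
move=> pR; rewrite inE (pcharf_prime pR) /= -mpolyC_nat.
by rewrite (pcharf0 pR) mpolyC0.
Qed.

Section Frobenius.
Variables (F : closedFieldType) (p e n : nat).
Hypothesis pF : p \in [pchar F].
Let q := (p ^ e)%N.

Let q_gt0 : (0 < q)%N.
Proof. by rewrite expn_gt0 (prime_gt0 (pcharf_prime pF)). Qed.

Lemma frob_root : exists rt : F -> F,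
  [/\ rt 0 = 0, forall a b, rt (a + b) = rt a + rt b,
      forall a b, rt (a ^+ q * b) = a * rt b & forall a, rt a = 0 -> a = 0].
Proof.
have ex (a : F) : exists b : F, b ^+ q = a.
  have : size ('X^q - a%:P) != 1.
    by rewrite size_XnsubC // eqSS -lt0n.
  move=> /closed_rootP[b]; rewrite rootE !hornerE subr_eq0 => /eqP.
  by exists b.
have [rt rtK] := choice ex; exists rt.
have inj (a b : F) : a ^+ q = b ^+ q -> a = b.
  move=> ab; apply/eqP; rewrite -subr_eq0.
  have : (a - b) ^+ q = 0.
    by rewrite exprDn_pchar ?exprNn_pchar ?pnat_pcharX // ab subrr.
  by move=> /eqP; rewrite expf_eq0 q_gt0.
have q0 : (0 : F) ^+ q = 0 by rewrite expr0n gtn_eqF.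
split=> [|a b|a b|a a0].
- by apply: inj; rewrite rtK q0.
- by apply: inj; rewrite exprDn_pchar ?pnat_pcharX // !rtK.
- by apply: inj; rewrite exprMn !rtK.
- by rewrite -(rtK a) a0 q0.
Qed.

Lemma frob_coord (b : 'X_{1..n}) : (forall i, b i < q)%N ->
  exists T : {mpoly F[n]} -> {mpoly F[n]},
  [/\ forall x y, T (x + y) = T x + T y, forall h g, T (h ^+ q * g) = h * T g
    & forall g, g@_b != 0 -> (T g)@_0%MM != 0].
Proof.
move=> bq; have [rt [rt0 rtD rtM rt_inj]] := frob_root.
pose T (g : {mpoly F[n]}) : {mpoly F[n]} :=
  \sum_(m : 'X_{1..n < msize g}) rt (g@_(m *+ q + b)) *: 'X_[m].
have TE g m : (T g)@_m = rt (g@_(m *+ q + b)).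
  have [mg|gm] := ltnP (mdeg m) (msize g).
    by rewrite (mcoeff_mpoly (fun m => rt g@_(m *+ q + b)) mg).
  rewrite [g@_(_)]memN_msupp_eq0 ?rt0; last first.
    apply: msize_mdeg_ge; apply: leq_trans gm _.
    by rewrite mdegD mdegMn; nia.
  rewrite raddf_sum big1 //= => -[k /= kg] _.
  rewrite mcoeffZ mcoeffX; case: eqP => [km|_]; last by rewrite mulr0.
  by move: kg; rewrite km ltnNge gm.
have TD x y : T (x + y) = T x + T y.
  by apply/mpolyP => m; rewrite mcoeffD !TE mcoeffD rtD.
exists T; split=> // [h g|g gb]; last first.
  apply: contraNneq gb; rewrite TE (_ : (0 *+ q + b)%MM = b) => [/rt_inj -> //|].
  by apply/mnmP => i; rewrite mnmDE mulmnE mnm0E.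
have qS : [pchar {mpoly F[n]}].-nat q by apply: pnat_pcharX; apply: pchar_mpoly.
elim/mpolyind: h => [|c m h _ _ IH].
  rewrite expr0n gtn_eqF // !mul0r; apply/mpolyP => m.
  by rewrite TE !mcoeff0 rt0.
rewrite exprDn_pchar // !mulrDl TD IH; congr (_ + _).
apply/mpolyP => k; rewrite TE exprZn -!scalerAl !mcoeffZ rtM; congr (_ * _).
rewrite mpolyXn ['X_[_] * g]mulrC ['X_[_] * T g]mulrC.
have [mk|mk] := boolP (m <= k)%MM.
  rewrite -(submK mk) [(k - m + m)%MM]addmC mcoeffMX TE; congr (rt _).
  rewrite -[RHS](mcoeffMX _ (m *+ q)); congr (_@__); apply/mnmP => i.
  by rewrite !(mnmDE, mulmnE) mulnDl addnA.
rewrite [RHS]mcoeff_MX_nle // mcoeff_MX_nle ?rt0 //.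
apply: contra mk => /mnm_lepP H; apply/mnm_lepP => i; move: (H i) (bq i).
rewrite mnmDE !mulmnE; nia.
Qed.

Lemma frob_colon (T : set {mpoly F[n]}) (c w : {mpoly F[n]}) (m : 'X_{1..n}) :
    is_ideal T -> (forall i, m i < q)%N -> w@_m != 0 ->
    ideal_gen [set y ^+ q | y in T] (w * c ^+ q) ->
  exists v, v@_0%MM != 0 /\ T (v * c).
Proof.
move=> iT mq wm [k [b [g [gT E]]]]; have [tr [trD trM tr0]] := frob_coord mq.
exists (tr w); split; first exact: tr0.
rewrite mulrC -trM mulrC E.
elim/big_ind: _ => [|x y Tx Ty|i _].
- rewrite (_ : tr 0 = 0); first by case: iT.
  by apply: (@addrI _ (tr 0)); rewrite -trD !addr0.
- by rewrite trD; case: iT => _ + _; apply.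
- by have [y Ty <-] := gT i; rewrite mulrC trM mulrC; case: iT => _ _; apply.
Qed.

End Frobenius.

(* Localising at the origin: if the q-th Frobenius power of T contains
   u w c^q with u a unit there and w <> 0 fixed, then for q beyond the order of
   w a Frobenius coordinate of u w is a unit v at the origin with v c in T. *)
Lemma frob_local (F : closedFieldType) (p n : nat) (T : set {mpoly F[n]})
    (c w : {mpoly F[n]}) : p \in [pchar F] -> is_ideal T -> w != 0 ->
    (forall e, exists u, u@_0%MM != 0 /\
       ideal_gen [set y ^+ (p ^ e) | y in T] (u * w * c ^+ (p ^ e))) ->
  exists v, v@_0%MM != 0 /\ T (v * c).
Proof.
move=> pF iT w0 H; pose d := mdeg (mlast w).
have dq : (d < p ^ d)%N by apply/ltn_expl/prime_gt1/(pcharf_prime pF).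
have [u [u0 Hu]] := H d.
apply: (frob_colon (m := mlast w) pF iT _ _ Hu) => [i|]; last first.
  by rewrite (mcoeff_mul_ord _ (@mlast_ord _ _ w) erefl) mulf_neq0 ?mcoeff_mlast.
by apply: leq_ltn_trans dq; rewrite /d mdegE (bigD1 i) //= leq_addr.
Qed.

Section FrobeniusPowers.
Variables (A : comNzRingType) (n : nat) (g : 'I_n -> A).

Lemma ideal_pow_prods (I : finType) (J : set A) (a : I -> nat) (x : I -> A) :
  (forall i, ideal_pow J (a i) (x i)) ->
  ideal_pow J (\sum_i a i) (\prod_i x i).
Proof.
move=> Jx; elim/big_rec2: _ => [|i y1 y2 _ IH]; first exact: ideal_pow0.
exact: ideal_powM.
Qed.

Lemma ideal_pow_frob r q N : (0 < n)%N -> (0 < q)%N -> ((r + n - 1) * q <= N)%N ->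
  ideal_pow (range g) N `<=`
  ideal_gen [set y ^+ q | y in ideal_pow (range g) r].
Proof.
move=> n0 q0 rN; apply: ideal_pow_min => [|f gf]; first exact: ideal_gen_ideal.
have [h hf] : exists h : 'I_N -> 'I_n, forall k, g (h k) = f k.
  have ex k : exists i, g i = f k by have [i _ <-] := gf k; exists i.
  by have [h hf] := choice ex; exists h.
pose al i := #|[pred k | h k == i]|.
have -> : \prod_(k < N) f k = \prod_(i < n) g i ^+ al i.
  rewrite (partition_big h predT) //=; apply: eq_bigr => i _.
  under eq_bigr => k /eqP ki do rewrite -hf ki.
  by rewrite prodr_const.
have sal : (\sum_(i < n) al i = N)%N.
  rewrite -[RHS]card_ord -sum1_card (partition_big h predT) //=.
  by apply: eq_bigr => i _; rewrite sum1_card.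
have -> : \prod_(i < n) g i ^+ al i =
    (\prod_(i < n) g i ^+ (al i %% q)) * (\prod_(i < n) g i ^+ (al i %/ q)) ^+ q.
  rewrite -prodrXl -big_split; apply: eq_bigr => i _ /=.
  by rewrite -exprM -exprD addnC -divn_eq.
have [_ _ IM] := ideal_gen_ideal [set y ^+ q | y in ideal_pow (range g) r].
apply: IM; apply: sub_ideal_gen; exists (\prod_(i < n) g i ^+ (al i %/ q)) => //.
have : ideal_pow (range g) (\sum_i al i %/ q) (\prod_(i < n) g i ^+ (al i %/ q)).
  by apply: ideal_pow_prods => i; apply: ideal_powX; exists i.
apply: ideal_pow_sub.
have : (N <= \sum_i (al i %/ q) * q + n * (q - 1))%N.
  rewrite -{1}sal -[n in (n * _)%N]card_ord -sum_nat_const -big_split /=.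
  apply: leq_sum => i _; rewrite {1}(divn_eq (al i) q) leq_add2l.
  by have := ltn_pmod (al i) q0; lia.
rewrite -big_distrl /=; set s := bigop _ _ _ => Ns.
rewrite leqNgt; apply/negP => sr.
move: rN Ns; rewrite (_ : r + n - 1 = s + n + (r - s.+1))%N; last by lia.
have nq : (n <= n * q)%N by apply: leq_pmulr.
by rewrite mulnBr muln1 !mulnDl; lia.
Qed.

End FrobeniusPowers.

(** * Linear dependence of polynomials *)

Section Degree.
Variables (n : nat) (R : comNzRingType).
Implicit Types (x y : {mpoly R[n]}).

Definition deg_le (d : nat) : set {mpoly R[n]} :=
  [set x | forall m : 'X_{1..n}, (d < mdeg m)%N -> x@_m = 0].

Lemma deg_leM a b x y : deg_le a x -> deg_le b y -> deg_le (a + b) (x * y).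
Proof.
move=> xa yb m mab; rewrite mcoeffM big1 // => -[k1 k2] /= /eqP /(congr1 (@mdeg n)).
rewrite mdegD => mE.
have [ak1|k1a] := ltnP a (mdeg k1); first by rewrite xa ?mul0r.
by rewrite yb ?mulr0 //; lia.
Qed.

Lemma deg_le1 : deg_le 0 1.
Proof. by move=> m m0; rewrite mcoeff1; case: eqP m0 => // ->; rewrite mdeg0. Qed.

Lemma deg_leX d x k : deg_le d x -> deg_le (d * k) (x ^+ k).
Proof.
move=> xd; elim: k => [|k IH]; first by rewrite muln0; apply: deg_le1.
by rewrite mulnS exprS; apply: deg_leM.
Qed.

Lemma deg_le_prod (I : finType) (d : I -> nat) (x : I -> {mpoly R[n]}) :
  (forall i, deg_le (d i) (x i)) -> deg_le (\sum_i d i) (\prod_i x i).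
Proof.
move=> xd; elim/big_rec2: _ => [|i y1 y2 _ IH]; first exact: deg_le1.
exact: deg_leM.
Qed.

Lemma deg_le_le a b x : (a <= b)%N -> deg_le a x -> deg_le b x.
Proof. by move=> ab xa m bm; apply: xa; apply: leq_ltn_trans bm. Qed.

Lemma deg_leXU i : deg_le 1 'X_i.
Proof.
move=> m m1; rewrite mcoeffX; case: eqP m1 => // <-; by rewrite mdeg1.
Qed.

Lemma deg_le_msize x : deg_le (msize x) x.
Proof. by move=> m mx; apply/memN_msupp_eq0/msize_mdeg_ge/ltnW. Qed.

End Degree.

Lemma card_bmultinom n E : (#|{: 'X_{1..n < E}}| <= E ^ n)%N.
Proof.
case: E => [|E].
  rewrite eq_card0 // => m; have := bmdeg m; by rewrite ltn0.
rewrite -[X in (_ <= X ^ _)%N]card_ord -[n in (_ ^ n)%N]card_ord -card_ffun.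
pose h (m : 'X_{1..n < E.+1}) := [ffun i : 'I_n => inord (m i) : 'I_E.+1].
apply: (leq_card h) => m1 m2 /ffunP H; apply/val_inj/mnmP => i.
have lt (m : 'X_{1..n < E.+1}) : (m i < E.+1)%N.
  by apply: leq_ltn_trans (bmdeg m); rewrite mdegE (bigD1 i) //= leq_addr.
by have := H i; rewrite !ffunE => /(congr1 val); rewrite /= !inordK.
Qed.

Lemma mpoly_lin_dep (F : fieldType) n E (T : finType) (P : T -> {mpoly F[n]}) :
    (forall k (m : 'X_{1..n}), (E <= mdeg m)%N -> (P k)@_m = 0) ->
    (E ^ n < #|T|)%N ->
  exists2 l : T -> F, exists k, l k != 0 & \sum_k l k *: P k = 0.
Proof.
move=> PE ET.
pose M := \matrix_(i < #|T|, j < #|{: 'X_{1..n < E}}|) (P (enum_val i))@_(enum_val j).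
have : kermx M != 0.
  rewrite kermx_eq0; apply/negP => /eqP rM; have := rank_leq_col M.
  by rewrite rM leqNgt (leq_ltn_trans (card_bmultinom n E)).
move=> /rowV0Pn[v /sub_kermxP vM v0]; exists (fun k => v ord0 (enum_rank k)).
  have [i vi] : exists i, v ord0 i != 0.
    apply/existsP; apply: contraNT v0; rewrite negb_exists => /forallP H.
    by apply/eqP/rowP => i; rewrite mxE; apply/eqP; have := H i; rewrite negbK.
  by exists (enum_val i); rewrite enum_valK.
apply/mpolyP => m; rewrite mcoeff0 raddf_sum /=.
have [Em|mE] := leqP E (mdeg m).
  by rewrite big1 // => k _; rewrite mcoeffZ PE ?mulr0.
have /rowP/(_ (enum_rank (BMultinom mE))) := vM; rewrite !mxE => H.
rewrite -[RHS]H (reindex (@enum_val T predT)) /=; last exact: onW_bij (enum_val_bij _).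
by apply: eq_bigr => i _; rewrite mxE mcoeffZ enum_valK enum_rankK.
Qed.

Lemma digits_inj s n (a b : 'I_n -> nat) :
  (forall i, a i < s)%N -> (forall i, b i < s)%N ->
  (\sum_(i < n) a i * s ^ i = \sum_(i < n) b i * s ^ i)%N -> a =1 b.
Proof.
elim: n a b => [|n IH] a b sa sb; first by move=> _ [].
have s0 : (0 < s)%N by apply: leq_ltn_trans (sa ord0).
rewrite !big_ord_recl /= expn0 !muln1.
have E (c : 'I_n.+1 -> nat) : (\sum_(i < n) c (lift ord0 i) * s ^ bump 0 i =
    (\sum_(i < n) c (lift ord0 i) * s ^ i) * s)%N.
  by rewrite big_distrl; apply: eq_bigr => i _; rewrite /= expnSr mulnA.
rewrite !E => H.
have ab0 : a ord0 = b ord0.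
  by have := congr1 (modn^~ s) H; rewrite ![(_ + _ * _)%N]addnC !modnMDl !modn_small.
move: H; rewrite ab0 => /addnI/eqP; rewrite eqn_mul2r gtn_eqF //= => /eqP.
move=> /(IH (fun i => a (lift ord0 i)) (fun i => b (lift ord0 i))) H i.
by case: (unliftP ord0 i) => [j ->|-> //]; apply: H.
Qed.

(* Kronecker substitution a_i = b^(s^i) turns distinct monomials with exponents
   below s into distinct powers of b. *)
Lemma nonroot_box (F : closedFieldType) n s (c : {ffun 'I_n -> 'I_s} -> F) al0 :
  c al0 != 0 -> exists a : 'I_n -> F,
  \sum_(al : {ffun 'I_n -> 'I_s}) c al * \prod_(i < n) a i ^+ al i != 0.
Proof.
move=> c0; pose k (al : {ffun 'I_n -> 'I_s}) := (\sum_(i < n) al i * s ^ i)%N.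
pose Q : {poly F} := \sum_al c al *: 'X^(k al).
have : Q != 0.
  apply: contraNneq c0 => Q0; have := coef0 F (k al0); rewrite -Q0 coef_sum.
  rewrite (bigD1 al0) //= coefZ coefXn eqxx mulr1 big1 ?addr0 => [->//|al ne].
  rewrite coefZ coefXn; case: eqP => [E|]; last by rewrite mulr0.
  case/eqP: ne; apply/ffunP => i; apply/val_inj.
  by rewrite /=; apply: (digits_inj (s := s) (a := fun i => al i) (b := fun i => al0 i)).
move=> /closed_nonrootP[b]; rewrite rootE => Qb; exists (fun i => b ^+ (s ^ i)).
rewrite (_ : \sum_al _ = Q.[b]) // horner_sum; apply: eq_bigr => al _.
rewrite hornerZ hornerXn /k expr_sum; congr (_ * _).
by apply: eq_bigr => i _; rewrite -exprM mulnC.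
Qed.

(** * Local reductions with n generators *)

Lemma ideal_pow_split (A : comNzRingType) (I T : set A) a b : is_ideal T ->
  (forall x y, ideal_pow I a x -> ideal_pow I b y -> T (x * y)) ->
  ideal_pow I (a + b) `<=` T.
Proof.
move=> iT TP; apply: ideal_pow_min => // g Ig; rewrite big_split_ord /=.
by apply: TP; apply: ideal_pow_prod => i; apply: Ig.
Qed.

Section Reduction.
Variables (F : closedFieldType) (n : nat) (i0 : 'I_n) (t : nat).
Hypothesis nt : (n <= t)%N.
Variable f : 'I_t.+1 -> {mpoly F[n]}.

Let I := range f.
Let f0 := f ord0.
Let fl (i : 'I_n) := f (lift ord0 (widen_ord nt i)).
Let mon s (al : {ffun 'I_n -> 'I_s}) : {mpoly F[n]} :=
  f0 ^+ (n * s - \sum_i al i) * \prod_i fl i ^+ al i.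

Let sum_al s (al : {ffun 'I_n -> 'I_s}) : (\sum_i al i <= n * s)%N.
Proof.
have : (\sum_(i < n) al i <= \sum_(i < n) s)%N by apply: leq_sum => i _; apply: ltnW.
by rewrite sum_nat_const card_ord.
Qed.

Let mon_pow s al : ideal_pow I (n * s) (@mon s al).
Proof.
rewrite -(subnK (sum_al al)); apply: ideal_powM; first by apply: ideal_powX; exists ord0.
by apply: ideal_pow_prods => i; apply: ideal_powX; exists (lift ord0 (widen_ord nt i)).
Qed.

(* Counting the monomials in n + 1 of the generators and in the variable i0
   gives a relation, whose lowest part in that variable is homogeneous in the
   generators. *)
Lemma homog_relation : exists s (c : {ffun 'I_n -> 'I_s} -> F) y,
  [/\ exists al, c al != 0, ideal_pow I (n * s) y &
      \sum_al c al *: mon al = 'X_i0 * y].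
Proof.
pose D := \max_i msize (f i).
have fD i : deg_le D (f i).
  by apply: deg_le_le (@deg_le_msize _ _ (f i)); apply: leq_bigmax.
pose s := ((n * D + 1) ^ n).+1.
have monD al : deg_le (D * (n * s)) (@mon s al).
  rewrite -{1}(subnK (sum_al al)) mulnDr; apply: deg_leM; first exact: deg_leX (fD _).
  by rewrite big_distrr; apply: deg_le_prod => i; apply: deg_leX (fD _).
pose P (k : {ffun 'I_n -> 'I_s} * 'I_s) := mon k.1 * 'X_i0 ^+ k.2.
have [||l [[al1 j1] l1] lP] := @mpoly_lin_dep F n ((n * D + 1) * s) _ P.
- move=> [al j] m Em; have := deg_leM (monD al) (deg_leX (k := j) (@deg_leXU n F i0)).
  apply; apply: leq_trans Em; rewrite mul1n.
  have := ltn_ord j; nia.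
- rewrite card_prod card_ffun !card_ord expnMn [X in (X < _)%N]mulnC ltn_pmul2l ?expn_gt0 //.
case: (@arg_minnP _ j1 (fun j => [exists al, l (al, j) != 0]) val).
  by apply/existsP; exists al1.
move=> j0 /existsP[al0 l0] jmin.
pose G al (j : 'I_s) := l (al, j) *: (mon al * 'X_i0 ^+ (j - j0)).
have X0 : 'X_i0 != 0 :> {mpoly F[n]}.
  apply/eqP => /(congr1 (mcoeff U_(i0)%MM)) /eqP.
  by rewrite mcoeffX eqxx mcoeff0 oner_eq0.
have : 'X_i0 ^+ j0 * (\sum_al \sum_j G al j) = 0.
  rewrite -[RHS]lP pair_bigA mulr_sumr; apply: eq_bigr => -[al j] _ /=.
  rewrite /G /P -scalerAr mulrCA -exprD /=.
  have [jj|jj] := leqP j0 j; first by rewrite subnKC.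
  suff -> : l (al, j) = 0 by rewrite !scale0r.
  apply/eqP; apply: contraTT jj => lj; rewrite -leqNgt; apply: jmin.
  by apply/existsP; exists al.
move=> /eqP; rewrite mulf_eq0 expf_eq0 (negPf X0) andbF /= => /eqP G0.
exists s, (fun al => l (al, j0)),
  (- \sum_al \sum_(j | j != j0) l (al, j) *: (mon al * 'X_i0 ^+ (j - j0).-1)).
have iI := ideal_pow_ideal I (n * s).
split; first by exists al0.
  apply: is_idealN => //; apply: is_ideal_sum => // al _.
  apply: is_ideal_sum => // j _; rewrite -mul_mpolyC mulrCA.
  by apply: is_idealMr => //; apply: mon_pow.
apply/eqP; rewrite mulrN -addr_eq0 -[X in _ == X]G0 mulr_sumr -big_split; apply/eqP.
apply: eq_bigr => al _ /=; rewrite [RHS](bigD1 j0) //= /G subnn expr0 mulr1.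
congr (_ + _); rewrite mulr_sumr; apply: eq_bigr => j jj0.
have [j0j|] := ltnP j0 j.
  rewrite -scalerAr mulrCA -exprS prednK //; by rewrite subn_gt0.
rewrite leq_eqVlt => /orP[/eqP E|jj]; first by case/eqP: jj0; apply: val_inj.
suff -> : l (al, j) = 0 by rewrite !scale0r mulr0.
apply/eqP; apply: contraTT jj => lj; rewrite -leqNgt; apply: jmin.
by apply/existsP; exists al.
Qed.

Section Drop.
Variable a : 'I_t -> F.
Let g i := f (lift ord0 i) - a i *: f0.

Let JI N : set {mpoly F[n]} :=
  [set x | exists y : 'I_t -> {mpoly F[n]},
    (forall i, ideal_pow I N (y i)) /\ x = \sum_i g i * y i].

Let JI_ideal N : is_ideal (JI N).
Proof.
have [I0 ID IM] := ideal_pow_ideal I N.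
split=> [|x x' [y [Iy ->]] [y' [Iy' ->]]|b x [y [Iy ->]]].
- by exists (fun=> 0); split=> //; rewrite big1 // => i _; rewrite mulr0.
- exists (fun i => y i + y' i); split=> [i|]; first exact: ID.
  by rewrite -big_split; apply: eq_bigr => i _; rewrite mulrDr.
- exists (fun i => b * y i); split=> [i|]; first exact: IM.
  by rewrite mulr_sumr; apply: eq_bigr => i _; rewrite mulrCA.
Qed.

Let JIM N M x z : JI N x -> ideal_pow I M z -> JI (N + M) (x * z).
Proof.
move=> [y [Iy ->]] Iz; exists (fun i => y i * z); split=> [i|].
  exact: ideal_powM.
by rewrite mulr_suml; apply: eq_bigr => i _; rewrite mulrA.
Qed.

Let JI_le N M x : (M <= N)%N -> JI N x -> JI M x.
Proof.
by move=> MN [y [Iy ->]]; exists y; split=> // i; apply: ideal_pow_sub (Iy i).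
Qed.

Let cong N x b := ideal_pow I N x /\ JI N.-1 (x - b * f0 ^+ N).

Let congM N M x y b c : cong N x b -> cong M y c -> cong (N + M) (x * y) (b * c).
Proof.
move=> [Ix xb] [Iy yc]; split; first exact: ideal_powM.
have -> : x * y - b * c * f0 ^+ (N + M) =
    (x - b * f0 ^+ N) * y + (y - c * f0 ^+ M) * (b * f0 ^+ N).
  rewrite exprD !mulrBl [y * _]mulrC addrA subrK; congr (_ - _).
  by rewrite mulrACA mulrC.
have [_ JD _] := JI_ideal (N + M).-1; apply: JD.
  by apply: JI_le (JIM xb Iy); lia.
have f0N : ideal_pow I N (b * f0 ^+ N).
  have [_ _ IM] := ideal_pow_ideal I N; apply: IM; apply: ideal_powX; by exists ord0.
by apply: JI_le (JIM yc f0N); lia.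
Qed.

Let cong0 b : cong 0 b b.
Proof.
split; first exact: ideal_pow0.
by rewrite expr0 mulr1 subrr; case: (JI_ideal 0.-1).
Qed.

Let cong_f0 : cong 1 f0 1.
Proof.
split; first by apply: ideal_pow1; exists ord0.
by rewrite mul1r expr1 subrr; case: (JI_ideal 1.-1).
Qed.

Let cong_fl i : cong 1 (f (lift ord0 i)) (a i)%:MP.
Proof.
split; first by apply: ideal_pow1; exists (lift ord0 i).
exists (fun j => (j == i)%:R); split=> [j|]; first exact: ideal_pow0.
rewrite (bigD1 i) //= eqxx mulr1 big1 ?addr0 => [|j /negPf->]; last by rewrite mulr0.
by rewrite mul_mpolyC expr1.
Qed.

Let congX N x b k : cong N x b -> cong (N * k) (x ^+ k) (b ^+ k).
Proof.
move=> xb; elim: k => [|k IH]; first by rewrite muln0; apply: cong0.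
by rewrite mulnS !exprS; apply: congM.
Qed.

Let cong_prod (T : finType) (N : T -> nat) x b :
  (forall i, cong (N i) (x i) (b i)) ->
  cong (\sum_i N i) (\prod_i x i) (\prod_i b i).
Proof.
move=> xb; elim/big_rec3: _ => [|i y1 y2 y3 _ IH]; first exact: cong0.
exact: congM.
Qed.

Let cong_sum N (T : finType) x b :
  (forall i : T, cong N (x i) (b i)) -> cong N (\sum_i x i) (\sum_i b i).
Proof.
move=> xb; split.
  by apply: is_ideal_sum => [|i _]; [apply: ideal_pow_ideal | case: (xb i)].
rewrite mulr_suml -sumrB; apply: is_ideal_sum => [|i _]; first exact: JI_ideal.
by case: (xb i).
Qed.

Let cong_ex N x : ideal_pow I N x -> exists b, cong N x b.
Proof.
move=> Ix; suff [b xb] : exists b, JI N.-1 (x - b * f0 ^+ N) by exists b.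
move: x Ix; apply: ideal_pow_min.
  have [J0 JD JM] := JI_ideal N.-1.
  split=> [|x y [b Hb] [c Hc]|u x [b Hb]].
  - by exists 0; rewrite mul0r subrr.
  - by exists (b + c); rewrite mulrDl opprD addrACA; apply: JD.
  - by exists (u * b); rewrite -mulrA -mulrBr; apply: JM.
move=> h Ih; have H k : exists b, cong 1 (h k) b.
  have [i _ <-] := Ih k; case: (unliftP ord0 i) => [j ->|->].
    by exists (a j)%:MP; apply: cong_fl.
  by exists 1; apply: cong_f0.
have [b Hb] := choice H; exists (\prod_k b k).
by have [_] := cong_prod Hb; rewrite sum1_card card_ord.
Qed.


Let cong_mon s (al : {ffun 'I_n -> 'I_s}) :
  cong (n * s) (mon al) (\prod_i a (widen_ord nt i) ^+ al i)%:MP.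
Proof.
rewrite -{1}(subnK (sum_al al)) -[_%:MP]mul1r; apply: congM.
  by have := congX (n * s - \sum_i al i) cong_f0; rewrite mul1n expr1n.
rewrite rmorph_prod /=; apply: cong_prod => i; rewrite rmorphXn /=.
by have := congX (al i) (cong_fl (widen_ord nt i)); rewrite mul1n.
Qed.

(* Modulo J I^(N-1), where J is generated by g and N = n s, every element of I^N
   is a multiple of f0^N, and the left-hand side of the relation is ka f0^N; hence
   (ka - x_i0 b) f0^N lies in J I^(N-1) if y is congruent to b f0^N. *)
Lemma drop_conductor s (c : {ffun 'I_n -> 'I_s} -> F) y :
    ideal_pow I (n * s) y -> \sum_al c al *: mon al = 'X_i0 * y ->
    \sum_al c al * \prod_i a (widen_ord nt i) ^+ al i != 0 ->
  exists2 u, u@_0%MM != 0 &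
    forall x, ideal_pow I (n * s) x -> JI (n * s).-1 (u * x).
Proof.
move=> Iy cy; set ka := bigop _ _ _ => ka0.
have [b yb] := cong_ex Iy; exists (ka%:MP - 'X_i0 * b).
  rewrite mcoeffB mcoeffC eqxx mulr1 (_ : ('X_i0 * b)@_0%MM = 0) ?subr0 //.
  apply/ord_ge1P; apply: (is_idealMr (T := ord_ge 1)); first exact: ord_ge_ideal.
  by apply/ord_ge1P; rewrite mcoeffX mnm1_eq0.
have [_ kaJ] : cong (n * s) ('X_i0 * y) ka%:MP.
  rewrite -cy /ka raddf_sum; apply: cong_sum => al.
  by rewrite -mul_mpolyC /= mpolyCM; exact: (congM (cong0 _) (cong_mon al)).
have [_ XbJ] := congM (cong0 'X_i0) yb; rewrite add0n in XbJ.
have [_ JD JM] := JI_ideal (n * s).-1.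
move=> x /cong_ex[d [_ xd]].
rewrite -[x](subrK (d * f0 ^+ (n * s))) mulrDr; apply: (JD); first exact: JM.
rewrite mulrCA; apply: JM; rewrite mulrBl.
have -> : ka%:MP * f0 ^+ (n * s) - 'X_i0 * b * f0 ^+ (n * s) =
    ('X_i0 * y - 'X_i0 * b * f0 ^+ (n * s)) - ('X_i0 * y - ka%:MP * f0 ^+ (n * s)).
  by rewrite opprB [RHS]addrC addrA subrK.
by apply: JD => //; apply: is_idealN.
Qed.

Lemma drop_power N u : (0 < N)%N ->
  (forall x, ideal_pow I N x -> JI N.-1 (u * x)) ->
  forall i x, ideal_pow I (N.-1 + i) x -> ideal_pow (range g) i (u ^+ i * x).
Proof.
move=> N0 uJ; elim=> [|i IH] x Ix; first exact: ideal_pow0.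
have : JI (N.-1 + i) (u * x).
  move: x Ix; rewrite addnS -addSn prednK //.
  apply: (ideal_pow_split (is_ideal_colon _ (JI_ideal _))) => x z Ix Iz /=.
  by rewrite mulrA; apply: JIM => //; apply: uJ.
move=> [y [Iy]]; rewrite exprSr -mulrA => ->.
rewrite mulr_sumr; apply: is_ideal_sum => [|j _]; first exact: ideal_pow_ideal.
by rewrite mulrCA; apply: ideal_powS; [exists j | apply: IH].
Qed.


End Drop.

Lemma drop_generator : exists (g : 'I_t -> {mpoly F[n]}) (k : nat) (u : {mpoly F[n]}),
  [/\ range g `<=` ideal_gen I, u@_0%MM != 0 &
      forall i x, ideal_pow I (k + i) x -> ideal_pow (range g) i (u ^+ i * x)].
Proof.
have [s [c [y [[al0 cal0] Iy cy]]]] := homog_relation.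
have [b cb] := nonroot_box cal0.
pose a (j : 'I_t) := if insub (j : nat) is Some i then b i else 0.
have aE i : a (widen_ord nt i) = b i.
  by rewrite /a /= insubT // => ilt; congr b; apply: val_inj.
have [|u u0 uJ] := @drop_conductor a s c y Iy cy.
  by under eq_bigr do under eq_bigr do rewrite aE.
have ns0 : (0 < n * s)%N.
  have := ltn_ord (al0 i0); have := ltn_ord i0.
  by rewrite muln_gt0 => /(leq_ltn_trans (leq0n _)) -> /(leq_ltn_trans (leq0n _)) ->.
exists (fun i => f (lift ord0 i) - a i *: f0), (n * s).-1, u; split=> //.
  have [_ ID IM] := ideal_gen_ideal I.
  move=> _ [i _ <-]; apply: ID; first by apply: sub_ideal_gen; exists (lift ord0 i).
  apply: is_idealN; first exact: ideal_gen_ideal.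
  by rewrite -mul_mpolyC; apply: IM; apply: sub_ideal_gen; exists ord0.
exact: drop_power ns0 uJ.
Qed.

End Reduction.

Lemma local_reduction (F : closedFieldType) (n : nat) (i0 : 'I_n) t
    (f : 'I_t -> {mpoly F[n]}) :
  exists (g : 'I_n -> {mpoly F[n]}) (k : nat), range g `<=` ideal_gen (range f) /\
    forall i, exists2 u, u@_0%MM != 0 &
      forall x, ideal_pow (range f) (k + i) x -> ideal_pow (range g) i (u * x).
Proof.
elim: t f => [|t IH] f.
  exists (fun=> 0), 0%N; split=> [_ [i _ <-]|i]; first exact: is_ideal0 (ideal_gen_ideal _).
  exists 1; first by rewrite mcoeff1 eqxx oner_eq0.
  by move=> x; rewrite add0n mul1r; apply: ideal_powS_set => y [[]].
have [nt|tn] := leqP n t.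
  have [g [k [u [gf u0 uP]]]] := drop_generator i0 nt f.
  have [h [l [hg hP]]] := IH g; exists h, (k + l)%N; split.
    by move=> x /hg; apply: ideal_gen_min => //; apply: ideal_gen_ideal.
  move=> i; have [v v0 vP] := hP i; exists (v * u ^+ (l + i)).
    by rewrite rmorphM rmorphXn mulf_neq0 // expf_neq0.
  by move=> x; rewrite -addnA -mulrA => /uP /vP.
pose g (i : 'I_n) := if insub (i : nat) is Some j then f j else 0.
exists g, 0%N; split=> [_ [i _ <-]|i].
  rewrite /g; case: insubP => [j _ _|_]; first by apply: sub_ideal_gen; exists j.
  exact: is_ideal0 (ideal_gen_ideal _).
exists 1; first by rewrite mcoeff1 eqxx oner_eq0.
move=> x; rewrite add0n mul1r; apply: ideal_powS_set => _ [j _ <-].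
exists (widen_ord tn j) => //; rewrite /g /= insubT // => jlt.
by congr f; apply: val_inj.
Qed.

(** * The Briancon-Skoda theorem *)

Section LocalBrianconSkoda.
Variables (F : closedFieldType) (p n : nat) (i0 : 'I_n).
Hypothesis pF : p \in [pchar F].

Lemma ideal_pow_zero (A : comNzRingType) (I : set A) r :
  I `<=` [set 0] -> (0 < r)%N -> ideal_pow I r `<=` [set 0].
Proof.
case: r => // r I0 _; apply: ideal_powS_min => [|x y /I0 -> _]; last by rewrite /= mul0r.
by split=> [//|x y -> ->|a x ->] /=; rewrite ?addr0 ?mulr0.
Qed.

Lemma local_briancon_skoda t (f : 'I_t -> {mpoly F[n]}) m r c :
    (r + n - 1 <= m)%N -> int_closure (ideal_pow (range f) m) c ->
  exists v, v@_0%MM != 0 /\ ideal_pow (range f) r (v * c).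
Proof.
move=> rm cI.
have [->|r0] := posnP r.
  exists 1; rewrite mcoeff1 eqxx oner_eq0; split=> //; exact: ideal_pow0.
have [[i fi]|f0] := pselect (exists i, f i != 0); last first.
  have fz : range f `<=` [set 0].
    by move=> _ [i _ <-]; apply/eqP; apply: contra_notT f0 => fi; exists i.
  have n0 : (0 < n)%N by apply: leq_ltn_trans (leq0n _) (ltn_ord i0).
  have m0 : (0 < m)%N by lia.
  exists 1; rewrite mcoeff1 eqxx oner_eq0; split=> //.
  have [k [a [k0 aI e]]] := cI.
  suff -> : c = 0 by rewrite mulr0; apply: is_ideal0 (ideal_pow_ideal _ _).
  apply/eqP; move: e; rewrite big_seq big1 ?addr0 => [/eqP|j].
    by rewrite expf_eq0 k0.
  rewrite mem_index_iota ltnS => jk; have /andP[j0 _] := jk.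
  by rewrite (ideal_pow_zero (ideal_pow_zero fz m0) j0 (aI j jk)) mul0r.
have [g [k [gf red]]] := local_reduction i0 f.
have [N cN] := int_closure_conductor cI.
pose w := (f i ^+ m) ^+ N * f i ^+ k.
have w0 : w != 0 by rewrite mulf_neq0 // ?expf_neq0.
have Ifi : range f (f i) by exists i.
have wI q : ideal_pow (range f) (k + m * q) (w * c ^+ q).
  rewrite /w mulrAC mulrC; apply: ideal_powM; first exact: ideal_powX.
  apply: (@ideal_pow_subM _ (ideal_pow (range f) m)) => //.
  by apply: cN; apply: ideal_powX; apply: ideal_powX.
have [|v [v0 vJ]] := frob_local (c := c) pF (ideal_pow_ideal (range g) r) w0.
  move=> e; have q0 : (0 < p ^ e)%N by rewrite expn_gt0 (prime_gt0 (pcharf_prime pF)).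
  have [u u0 uJ] := red (m * p ^ e)%N; exists u; split=> //.
  rewrite -mulrA; apply: ideal_pow_frob (uJ _ (wI _)) => //.
    by apply: leq_ltn_trans (leq0n _) (ltn_ord i0).
  by rewrite leq_mul2r rm orbT.
exists v; split=> //.
by have /ideal_pow_gen := ideal_powS_set gf vJ.
Qed.

End LocalBrianconSkoda.

Section FinitelyManyGenerators.
Variable A : comNzRingType.
Implicit Types (I : set A).

Lemma ideal_pow_fin I r x : ideal_pow I r x ->
  exists s : seq A, [set y | y \in s] `<=` I /\ ideal_pow [set y | y \in s] r x.
Proof.
move: x; apply: (ideal_pow_min (T := [set x | exists s : seq A,
  [set y | y \in s] `<=` I /\ ideal_pow [set y | y \in s] r x])) => [|g Ig].
  split=> [|x y [s [sI sx]] [s' [sI' sy]]|a x [s [sI sx]]].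
  - by exists nil; split=> //; apply: is_ideal0 (ideal_pow_ideal _ _).
  - exists (s ++ s'); split=> [z /=|].
      by rewrite mem_cat => /orP[/sI|/sI'].
    have [_ ID _] := ideal_pow_ideal [set z | z \in s ++ s'] r; apply: ID.
      by apply: ideal_powS_set sx => z /= zs; rewrite mem_cat zs.
    by apply: ideal_powS_set sy => z /= zs; rewrite mem_cat zs orbT.
  - by exists s; split=> //; case: (ideal_pow_ideal [set z | z \in s] r) => _ _; apply.
exists (codom g); split=> [y /= /codomP[i ->] //|].
by apply: ideal_pow_prod => i; apply: codom_f.
Qed.

Lemma ideal_pow_powM I m j : ideal_pow I (m * j) `<=` ideal_pow (ideal_pow I m) j.
Proof.
elim: j => [|j IH]; first by move=> x _; apply: ideal_pow0.
rewrite mulnS; apply: ideal_pow_split => [|x y Ix /IH Iy]; first exact: ideal_pow_ideal.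
exact: ideal_powS.
Qed.

Lemma ideal_pow_powE I m j : ideal_pow (ideal_pow I m) j = ideal_pow I (m * j).
Proof. by apply/seteqP; split; [apply: ideal_pow_subM | apply: ideal_pow_powM]. Qed.

Lemma ideal_pow_rangeP t (f : 'I_t -> A) r x : ideal_pow (range f) r x ->
  exists b : {ffun 'I_r -> 'I_t} -> A, x = \sum_h b h * \prod_k f (h k).
Proof.
move: x; apply: (ideal_pow_min (T := [set x | exists b : {ffun 'I_r -> 'I_t} -> A,
  x = \sum_h b h * \prod_k f (h k)])) => [|g Ig].
  split=> [|x y [b ->] [b' ->]|a x [b ->]].
  - by exists (fun=> 0); rewrite big1 // => h _; rewrite mul0r.
  - by exists (fun h => b h + b' h); rewrite -big_split; apply: eq_bigr => h _; rewrite mulrDl.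
  - by exists (fun h => a * b h); rewrite mulr_sumr; apply: eq_bigr => h _; rewrite mulrA.
have ex k : exists i, f i = g k by have [i _ <-] := Ig k; exists i.
have [h hf] := choice ex; exists (fun h' => (h' == [ffun k => h k])%:R).
rewrite (bigD1 [ffun k => h k]) //= eqxx mul1r [X in _ = _ + X]big1 ?addr0 => [|h' /negPf ->].
  by apply: eq_bigr => k _; rewrite ffunE hf.
by rewrite mul0r.
Qed.

Lemma int_closure_fin I m c : int_closure (ideal_pow I m) c ->
  exists t (f : 'I_t -> A), range f `<=` I /\ int_closure (ideal_pow (range f) m) c.
Proof.
move=> [n [a [n0 aI e]]].
have ex j : exists s : seq A, [set y | y \in s] `<=` I /\
    ((1 <= j <= n)%N -> ideal_pow [set y | y \in s] (m * j) (a j)).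
  have [jn|nj] := boolP (1 <= j <= n)%N; last by exists nil.
  have := aI j jn; rewrite ideal_pow_powE => /ideal_pow_fin[s [sI sa]].
  by exists s.
have [s sP] := choice ex; pose S := flatten [seq s j | j <- iota 1 n].
exists (size S), (tnth (in_tuple S)); split=> [_ [i _ <-]|].
  have /flattenP[s' /mapP[j _ ->] xs] := mem_tnth i (in_tuple S).
  by have [+ _] := sP j; apply.
exists n, a; split=> // j jn; rewrite ideal_pow_powE.
have [_ /(_ jn)] := sP j; apply: ideal_powS_set => y /= ys.
have yS : y \in in_tuple S.
  by apply/flattenP; exists (s j) => //; apply: map_f; rewrite mem_iota; lia.
by have [i ->] := tnthP _ _ yS; exists i.
Qed.

End FinitelyManyGenerators.

Section HomogeneousIdeals.
Variables (n : nat) (R : comNzRingType).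
Implicit Types (x y : {mpoly R[n]}).

Lemma pihomogM_in (T : set {mpoly R[n]}) x y e : is_ideal T ->
  (forall i j, T (pihomog mdeg i x * pihomog mdeg j y)) -> T (pihomog mdeg e (x * y)).
Proof.
move=> iT Txy.
rewrite {1}[x](pihomog_partitionE (leqnn (msize x))) {1}[y](pihomog_partitionE (leqnn (msize y))).
rewrite mulr_suml raddf_sum; apply: is_ideal_sum => // i _ /=.
rewrite mulr_sumr raddf_sum; apply: is_ideal_sum => // j _ /=.
have hom : pihomog mdeg i x * pihomog mdeg j y \is (i + j).-homog.
  by apply: dhomogM; apply: pihomogP.
have [ije|ije] := eqVneq (i + j)%N e; last by rewrite (pihomog_ne0 ije) //; apply: is_ideal0.
by rewrite -ije pihomog_dE.
Qed.

Lemma ideal_pow_homog (I : set {mpoly R[n]}) r x e :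
    is_ideal I -> (forall y i, I y -> I (pihomog mdeg i y)) ->
  ideal_pow I r x -> ideal_pow I r (pihomog mdeg e x).
Proof.
move=> iI hI; elim: r x e => [|r IH] x e; first by move=> _; apply: ideal_pow0.
move=> Ix; move: x Ix e.
apply: (ideal_powS_min (T := [set x | forall e, ideal_pow I r.+1 (pihomog mdeg e x)])).
  split=> [e|x y Ix Iy e|a x Ix e] /=.
  - by rewrite pihomog0; apply: is_ideal0 (ideal_pow_ideal _ _).
  - by rewrite pihomogD; case: (ideal_pow_ideal I r.+1) => _ + _; apply.
  - apply: pihomogM_in => [|i j]; first exact: ideal_pow_ideal.
    by case: (ideal_pow_ideal I r.+1) => _ _; apply; apply: Ix.
move=> x y Ix Iy e /=; apply: pihomogM_in => [|i j]; first exact: ideal_pow_ideal.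
by apply: ideal_powS; [apply: hI | apply: IH].
Qed.

Lemma homog_ideal_closed (T : set {mpoly R[n]}) c y : is_ideal T ->
    (forall x i, T x -> T (pihomog mdeg i x)) ->
  T y -> ord_ge (msize c) (c - y) -> T c.
Proof.
move=> iT hT Ty cy; rewrite [c](pihomog_partitionE (leqnn (msize c))).
apply: is_ideal_sum => // i _; rewrite -[X in pihomog _ _ X](subrK y) pihomogD.
rewrite (_ : pihomog mdeg i (c - y) = 0) ?add0r; first exact: hT.
by rewrite pihomogE big1_seq // => m /andP[/eqP mi _]; rewrite cy ?scale0r // mi.
Qed.

End HomogeneousIdeals.

Lemma span_or_separate (K : fieldType) n d (T : finType) (P : T -> {mpoly K[n]}) c :
  (exists l : T -> K, ord_ge d (c - \sum_k l k *: P k)) \/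
  (exists w : 'X_{1..n < d} -> K,
     (forall k, \sum_m w m * (P k)@_m = 0) /\ \sum_m w m * c@_m != 0).
Proof.
pose M := \matrix_(i < #|T|, j < #|{: 'X_{1..n < d}}|) (P (enum_val i))@_(enum_val j).
pose v := \row_(j < #|{: 'X_{1..n < d}}|) c@_(enum_val j).
have [/submxP[l lE]|vM] := boolP (v <= M)%MS; [left|right].
  exists (fun k => l ord0 (enum_rank k)) => m md.
  have /rowP/(_ (enum_rank (BMultinom md))) := lE; rewrite !mxE enum_rankK /= => E.
  rewrite mcoeffB E raddf_sum /= [X in _ - X](reindex (@enum_val T predT)) /=;
    last exact: onW_bij (enum_val_bij _).
  rewrite -sumrB big1 // => i _; by rewrite mxE mcoeffZ enum_valK enum_rankK subrr.
rewrite submxE in vM.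
have [j vj] : exists j, (v *m cokermx M) ord0 j != 0.
  apply/existsP; apply: contraNT vM; rewrite negb_exists => /forallP H.
  by apply/eqP/rowP => j; rewrite [RHS]mxE; apply/eqP; have := H j; rewrite negbK.
exists (fun m => cokermx M (enum_rank m) j); split=> [k|].
  have /matrixP/(_ (enum_rank k) j) := mulmx_coker M; rewrite mxE [RHS]mxE => H.
  rewrite -[RHS]H (reindex (@enum_val {: 'X_{1..n < d}} predT)) /=;
    last exact: onW_bij (enum_val_bij _).
  by apply: eq_bigr => i _; rewrite enum_valK [M _ _]mxE enum_rankK mulrC.
apply: contraNneq vj => H; rewrite mxE -[X in _ == X]H.
rewrite [X in _ == X](reindex (@enum_val {: 'X_{1..n < d}} predT)) /=;
    last exact: onW_bij (enum_val_bij _).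
by apply/eqP/eq_bigr => i _; rewrite [v _ _]mxE enum_valK mulrC.
Qed.

Lemma ord_ge_inverse (F : fieldType) n d (v : {mpoly F[n]}) :
  v@_0%MM != 0 -> exists v', ord_ge d (1 - v' * v).
Proof.
move=> v0; pose z := 1 - (v@_0%MM)^-1 *: v.
have vz : (v@_0%MM)^-1 *: v = 1 - z by rewrite opprB addrC subrK.
exists ((\sum_(i < d) z ^+ i) * ((v@_0%MM)^-1)%:MP).
have -> : 1 - (\sum_(i < d) z ^+ i) * ((v@_0%MM)^-1)%:MP * v = z ^+ d.
  rewrite -mulrA mul_mpolyC vz mulrC -(opprB z) mulNr -subrX1 opprK.
  by rewrite addrC subrK.
have := ord_geX (d := 1) (k := d) (x := z); rewrite mul1n; apply.
apply/ord_ge1P; rewrite mcoeffB mcoeff1 mcoeffZ eqxx mulVf //; exact: subrr.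
Qed.

Lemma mpoly_lift (K B : comNzRingType) (e : {rmorphism B -> K}) n (x : {mpoly K[n]}) :
  (forall a, a \in [seq x@_m | m <- msupp x] -> exists b, e b = a) ->
  exists y : {mpoly B[n]}, map_mpoly e y = x.
Proof.
move=> cov.
have ex m : exists b, m \in msupp x -> e b = x@_m.
  have [mx|_] := boolP (m \in msupp x); last by exists 0.
  by have [b eb] := cov _ (map_f _ mx); exists b.
have [b bP] := choice ex; exists (\sum_(m <- msupp x) b m *: 'X_[m]).
rewrite [RHS]mpolyE raddf_sum /= big_seq [RHS]big_seq.
by apply: eq_bigr => m mx; rewrite map_mpolyZ map_mpolyX bP.
Qed.

Lemma map_mpoly_ker (K B F : comNzRingType) (e : {rmorphism B -> K})
    (e' : {rmorphism B -> F}) n (y : {mpoly B[n]}) :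
  (forall b, e b = 0 -> e' b = 0) -> map_mpoly e y = 0 -> map_mpoly e' y = 0.
Proof.
move=> ker y0; apply/mpolyP => m; rewrite mcoeff_map_mpoly mcoeff0; apply: ker.
by rewrite -mcoeff_map_mpoly y0 mcoeff0.
Qed.

Theorem briancon_skoda (K : fieldType) n (i0 : 'I_n) (I : set {mpoly K[n]}) m r c :
    is_ideal I -> (forall x i, I x -> I (pihomog mdeg i x)) -> (r + n - 1 <= m)%N ->
  int_closure (ideal_pow I m) c -> ideal_pow I r c.
Proof.
move=> iI hI rm cI; apply: contrapT => nIc.
have [t [f [fI [nu [a [nu0 aI ea]]]]]] := int_closure_fin cI.
pose d := msize c.
pose P (k : 'X_{1..n < d} * {ffun 'I_r -> 'I_t}) := 'X_[k.1] * \prod_i f (k.2 i).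
have iIr := ideal_pow_ideal I r.
have [[l lP]|[w [wP wc]]] := span_or_separate d P c.
  apply: nIc; apply: (homog_ideal_closed iIr _ _ lP).
    by move=> x i; apply: ideal_pow_homog.
  apply: is_ideal_sum => // k _; rewrite -mul_mpolyC /P mulrA.
  have [_ _ IM] := iIr; apply: IM; apply: ideal_pow_prod => i.
  by apply: fI; exists (k.2 i).
have ex j : exists s : seq {mpoly K[n]}, (1 <= j <= nu)%N ->
    a j = \sum_(h : {ffun 'I_(m * j) -> 'I_t}) s`_(enum_rank h) * \prod_k f (h k).
  have [jn|_] := boolP (1 <= j <= nu)%N; last by exists nil.
  have := aI j jn; rewrite ideal_pow_powE => /ideal_pow_rangeP[b ->].
  exists (codom b) => _; apply: eq_bigr => h _; congr (_ * _).
  by rewrite nth_codom enum_rankK.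
have [s sP] := choice ex.
pose L := 0 :: c :: codom f ++ flatten [seq s j | j <- iota 1 nu].
pose cs := codom w ++ flatten [seq [seq x@_m | m <- msupp x] | x : {mpoly K[n]} <- L].
have [B [e [spec cov]]] := specializable_seq cs.
have lift x : exists y, x \in L -> map_mpoly e y = x.
  have [xL|_] := boolP (x \in L); last by exists 0.
  have [|y yx] := @mpoly_lift _ _ e _ x; last by exists y.
  move=> b bx; apply: cov; rewrite mem_cat; apply/orP; right.
  by apply/flattenP; exists [seq x@_m | m <- msupp x] => //; apply/mapP; exists x.
have [sg sgP] := choice lift.
have exw mu : exists b, e b = w mu by apply: cov; rewrite mem_cat codom_f.
have [w' w'P] := choice exw.
have fL i : map_mpoly e (sg (f i)) = f i.
  by apply: sgP; rewrite !inE mem_cat codom_f !orbT.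
have cL : map_mpoly e (sg c) = c by apply: sgP; rewrite !inE eqxx orbT.
have sL j k : (1 <= j <= nu)%N -> map_mpoly e (sg (s j)`_k) = (s j)`_k.
  move=> jn; apply: sgP; have [ks|ks] := ltnP k (size (s j)); last first.
    by rewrite nth_default // inE eqxx.
  rewrite !inE mem_cat; apply/orP; right; apply/orP; right; apply/orP; right.
  apply/flattenP; exists (s j); last exact: mem_nth.
  by apply: map_f; rewrite mem_iota; lia.
pose a' j := \sum_(h : {ffun 'I_(m * j) -> 'I_t})
  sg (s j)`_(enum_rank h) * \prod_k sg (f (h k)).
have aL j : (1 <= j <= nu)%N -> map_mpoly e (a' j) = a j.
  move=> jn; rewrite [RHS]sP // rmorph_sum; apply: eq_bigr => h _.
  by rewrite rmorphM rmorph_prod /= sL //; congr (_ * _); apply: eq_bigr => k _; rewrite fL.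
have eg : e (\sum_mu w' mu * (sg c)@_mu) != 0.
  rewrite (_ : e _ = \sum_mu w mu * c@_mu) // rmorph_sum; apply: eq_bigr => mu _.
  by rewrite rmorphM /= w'P -mcoeff_map_mpoly cL.
have [F [p [e' [pF ker g0]]]] := spec _ eg.
pose W (x : {mpoly F[n]}) := \sum_(mu : 'X_{1..n < d}) e' (w' mu) * x@_mu.
have WD x y : W (x + y) = W x + W y.
  by rewrite -big_split; apply: eq_bigr => mu _; rewrite mcoeffD mulrDr.
have Word x : ord_ge d x -> W x = 0.
  by move=> xd; rewrite /W big1 // => mu _; rewrite xd ?bmdeg // mulr0.
pose f' i := map_mpoly e' (sg (f i)).
have Wprod u (h : 'I_r -> 'I_t) : W (u * \prod_k f' (h k)) = 0.
  elim/mpolyind: u => [|b mu u _ _ IH]; first by rewrite mul0r Word // => mu; rewrite mcoeff0.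
  rewrite mulrDl WD IH addr0 -scalerAl.
  have -> x : W (b *: x) = b * W x.
    by rewrite /W mulr_sumr; apply: eq_bigr => ? _; rewrite mcoeffZ mulrCA.
  rewrite (_ : W _ = 0) ?mulr0 //; have [dmu|dmu] := leqP d (mdeg mu).
    apply: Word; apply: (is_idealMr (T := ord_ge d)); first exact: ord_ge_ideal.
    move=> m' m'd; rewrite mcoeffX; case: eqP => // E.
    by move: m'd; rewrite -E ltnNge dmu.
  pose y := 'X_[mu] * \prod_k sg (f (h k)).
  have -> : 'X_[mu] * \prod_k f' (h k) = map_mpoly e' y.
    by rewrite rmorphM rmorph_prod /= map_mpolyX.
  have -> : W (map_mpoly e' y) = e' (\sum_(m' : 'X_{1..n < d}) w' m' * y@_m').
    rewrite rmorph_sum; apply: eq_bigr => m' _.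
    by rewrite mcoeff_map_mpoly rmorphM.
  apply: ker; rewrite rmorph_sum -[RHS](wP (BMultinom dmu, [ffun k => h k])).
  apply: eq_bigr => m' _; rewrite rmorphM /= w'P -mcoeff_map_mpoly rmorphM rmorph_prod /=.
  rewrite map_mpolyX; congr (_ * (_ * _)@__); apply: eq_bigr => k _.
  by rewrite fL ffunE.
have Wpow x : ideal_pow (range f') r x -> forall u, W (u * x) = 0.
  move: x; apply: (ideal_pow_min (T := [set x | forall u, W (u * x) = 0])).
    split=> [u|x y Wx Wy u|b x Wx u] /=; first by rewrite mulr0 Word // => ? _; rewrite mcoeff0.
      by rewrite mulrDr WD Wx Wy addr0.
    by rewrite mulrA.
  move=> g gf u; have exh k : exists i, f' i = g k by have [i _ <-] := gf k; exists i.
  have [h hf] := choice exh; rewrite -(Wprod u h).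
  by congr (W (_ * _)); apply: eq_bigr => k _; rewrite hf.
have cint : int_closure (ideal_pow (range f') m) (map_mpoly e' (sg c)).
  exists nu, (fun j => map_mpoly e' (a' j)); split=> // [j jn|].
    rewrite ideal_pow_powE rmorph_sum.
    apply: is_ideal_sum => [|h _]; first exact: ideal_pow_ideal.
    rewrite rmorphM rmorph_prod /=; have [_ _ IM] := ideal_pow_ideal (range f') (m * j).
    by apply: IM; apply: ideal_pow_prod => k; exists (h k).
  have hE (R0 : comNzRingType) (h : {rmorphism B -> R0}) :
      map_mpoly h (sg c ^+ nu + \sum_(1 <= j < nu.+1) a' j * sg c ^+ (nu - j)) =
      map_mpoly h (sg c) ^+ nu +
        \sum_(1 <= j < nu.+1) map_mpoly h (a' j) * map_mpoly h (sg c) ^+ (nu - j).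
    rewrite rmorphD rmorphXn rmorph_sum /=; congr (_ + _).
    by apply: eq_bigr => j _; rewrite rmorphM rmorphXn.
  rewrite -hE; apply: (map_mpoly_ker ker); rewrite hE cL -[RHS]ea; congr (_ + _).
  rewrite big_nat [RHS]big_nat; apply: eq_bigr => j jn; by rewrite aL.
have [v [v0 vc]] := local_briancon_skoda i0 pF rm cint.
have [v' vv] := ord_ge_inverse d v0.
case/eqP: g0.
rewrite (_ : e' _ = W (map_mpoly e' (sg c))); last first.
  by rewrite rmorph_sum; apply: eq_bigr => mu _; rewrite rmorphM mcoeff_map_mpoly.
rewrite -[map_mpoly _ _]mul1r -(subrK (v' * v) 1) mulrDl WD -mulrA (Wpow _ vc) addr0.
by apply: Word; apply: (is_idealMr (T := ord_ge d)) vv; apply: ord_ge_ideal.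
Qed.

(** * Resurgence *)

Lemma idealr_closed_ideal (A : comNzRingType) (I : set A) :
  idealr_closed (mem I) -> is_ideal I /\ ~ I 1.
Proof.
move=> [I0 I1 IM]; split; last by move=> /mem_set h; case/negP: I1.
split=> [|x y Ix Iy|a x Ix]; first exact: set_mem.
  by have := IM 1 x y (mem_set Ix) (mem_set Iy); rewrite mul1r => /set_mem.
by have := IM a x 0 (mem_set Ix) I0; rewrite addr0 => /set_mem.
Qed.

Lemma ideal_pow_ord n (R : comNzRingType) (I : set {mpoly R[n]}) d r :
  I `<=` ord_ge d -> ideal_pow I r `<=` ord_ge (d * r).
Proof.
move=> Id; elim: r => [|r IH]; first by move=> x _; rewrite muln0; apply: ord_ge0.
apply: ideal_powS_min => [|x y /Id xd /IH yd]; first exact: ord_ge_ideal.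
by rewrite mulnS; apply: ord_geM.
Qed.

Section HomogeneousPowers.
Variables (K : fieldType) (n : nat) (I : set {mpoly K[n]}).
Hypothesis hI : proper_homog_ideal I.
Hypothesis I0 : I <> [set 0].

Lemma ideal_pow_proper m : ~ (ideal_pow I m `<=` ideal_pow I m.+1).
Proof.
have [/idealr_closed_ideal[iI I1] homI] := hI.
have ex : exists d, `[< exists x, [/\ I x, x != 0 & x \is d.-homog] >].
  have [x Ix x0] : exists2 x, I x & x != 0.
    apply: contrapT => nx; apply: I0; apply/seteqP; split=> [x Ix|_ ->]; last exact: is_ideal0.
    by apply/eqP; apply: contra_notT nx => x0; exists x.
  have [d xd] : exists d, pihomog mdeg d x != 0.
    apply: contrapT => nd; case/eqP: x0; rewrite [x](pihomog_partitionE (leqnn (msize x))).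
    by rewrite big1 // => d _; apply/eqP; apply: contra_notT nd => xd; exists d.
  exists d; apply/asboolP; exists (pihomog mdeg d x).
  by split=> //; [apply: homI | apply: pihomogP].
case: (ex_minnP ex) => d /asboolP[x [Ix x0 xd]] dmin.
have Id : I `<=` ord_ge d.
  move=> y Iy m' m'd; rewrite [y](pihomog_partitionE (leqnn (msize y))) raddf_sum big1 //= => i _.
  have [m'i|m'i] := eqVneq (mdeg m') i; last exact: dhomog_nemf_coeff (pihomogP _ _ _) m'i.
  have [->|yi0] := eqVneq (pihomog mdeg i y) 0; first by rewrite mcoeff0.
  have : (d <= i)%N.
    apply: dmin; apply/asboolP; exists (pihomog mdeg i y).
    by split=> //; [apply: homI | apply: pihomogP].
  by rewrite -m'i leqNgt m'd.
have d0 : (0 < d)%N.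
  rewrite lt0n; apply/negP => /eqP d0; rewrite d0 in xd.
  have xE : x = (x@_0%MM)%:MP.
    apply/mpolyP => m'; rewrite mcoeffC; have [->|m'0] := eqVneq m' 0%MM.
      by rewrite mulr1.
    by rewrite mulr0; apply: (dhomog_nemf_coeff xd); rewrite mdeg_eq0.
  apply: I1; have [_ _ IM] := iI; have := IM ((x@_0%MM)^-1)%:MP _ Ix.
  rewrite {2}xE -mpolyCM mulVf ?mpolyC1 //.
  by apply: contraNneq x0 => x00; rewrite xE x00 mpolyC0.
move=> /(_ _ (ideal_powX m Ix)) /(ideal_pow_ord Id) H.
have xm0 : x ^+ m != 0 by rewrite expf_neq0.
have := mlast_supp xm0; rewrite mcoeff_msupp H ?eqxx //.
have /dhomogP -> := dhomogMn m xd; first by rewrite ltn_pmul2l.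
exact: mlast_supp.
Qed.

End HomogeneousPowers.

Section Resurgence.
Variables (R : realType) (K : fieldType) (N : nat).
Variable I : set {mpoly K[N.+1]}.
Hypothesis hI : proper_homog_ideal I.
Hypothesis I0 : I <> [set 0].
Local Open Scope ereal_scope.

Lemma int_ratio_bound m r : ~ (int_closure (ideal_pow I m) `<=` ideal_pow I r) ->
  (m < r + N)%N.
Proof.
have [/idealr_closed_ideal[iI _] homI] := hI.
move=> nc; rewrite ltnNge; apply/negP => rm; apply: nc => c.
by apply: (briancon_skoda ord0 iI homI); lia.
Qed.

Lemma int_ratio_succ m : (0 < m)%N -> int_ratios R I (m%:R / m.+1%:R)%:E.
Proof.
move=> m0; exists m, m.+1; split=> // nc.
by apply: (ideal_pow_proper hI I0 (m := m)) => x /sub_int_closure /nc.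
Qed.

Lemma int_resurgence_ge1 : 1%:E <= int_resurgence R I.
Proof.
apply/lee_addgt0Pr => e e0.
have [m me] : exists m, (m.+1%:R^-1 < e)%R.
  have := archi_boundP (ltW (_ : 0 < e^-1)%R); rewrite invr_gt0 => /(_ e0) H.
  exists (Num.bound e^-1); rewrite invf_plt ?posrE //.
  by apply: lt_le_trans H _; rewrite ler_nat.
have H : ((m.+1%:R / m.+2%:R)%:E <= int_resurgence R I).
  by apply: ereal_sup_ubound; apply: int_ratio_succ.
apply: le_trans (leeD2r _ H); rewrite -EFinD lee_fin.
rewrite -lerBlDl -[X in (X - _)%R](@divff _ (m.+2%:R : R)) ?pnatr_eq0 //.
rewrite -mulrBl -natrB // subSnn mul1r; apply: le_trans (ltW me).
by rewrite lef_pV2 ?posrE ?ltr0n // ler_nat.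
Qed.

Lemma int_ratios_max q0 : int_ratios R I q0 -> 1%:E < q0 ->
  exists2 q, int_ratios R I q & ubound (int_ratios R I) q.
Proof.
move=> [m0 [r0 [m00 r00 nc0 ->]]].
rewrite lte_fin ltr_pdivlMr ?ltr0n // mul1r ltr_nat => r0m0.
have small m r : (0 < r)%N -> ~ (int_closure (ideal_pow I m) `<=` ideal_pow I r) ->
    (m0%:R / r0%:R <= m%:R / r%:R :> R)%R -> (r < (N * r0).+1)%N /\ (m < (N * r0).+1 + N)%N.
  move=> r_gt0 /int_ratio_bound mrN.
  rewrite ler_pdivrMr ?ltr0n // mulrAC ler_pdivlMr ?ltr0n // -!natrM ler_nat => le.
  suff rN : (r < N * r0)%N by lia.
  have h1 : (r0.+1 * r <= m0 * r)%N by rewrite leq_mul2r r0m0 orbT.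
  have h2 : (m * r0 < (r + N) * r0)%N by rewrite ltn_mul2r r00 mrN.
  by move: (leq_ltn_trans (leq_trans h1 le) h2); rewrite mulSn mulnDl mulnC; lia.
have [hr hm] := small _ _ r00 nc0 (lexx _).
pose T := ('I_((N * r0).+1 + N) * 'I_(N * r0).+1)%type.
pose P (k : T) := `[< [/\ (0 < k.1)%N, (0 < k.2)%N &
   ~ (int_closure (ideal_pow I k.1) `<=` ideal_pow I k.2)] >].
pose G (k : T) : R := (k.1%:R / k.2%:R)%R.
have P0 : P (Ordinal hm, Ordinal hr) by apply/asboolP.
case: (@Order.TotalTheory.arg_maxP _ R T _ P G P0) => -[m r] /asboolP[/= m_gt0 r_gt0 nc] mmax.
exists (m%:R / r%:R)%:E; first by exists m, r.
move=> _ [m' [r' [m'0 r'0 nc' ->]]]; rewrite lee_fin.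
have [le|/ltW lt] := leP (m0%:R / r0%:R : R)%R (m'%:R / r'%:R)%R; last first.
  exact: le_trans lt (mmax _ P0).
have [hr' hm'] := small _ _ r'0 nc' le.
by apply: (mmax (Ordinal hm', Ordinal hr')); apply/asboolP.
Qed.

Lemma int_resurgence_max :
  is_maximum (int_ratios R I `|` [set 1%:E]) (int_resurgence R I).
Proof.
have ub : ubound (int_ratios R I) (int_resurgence R I).
  by move=> q; apply: ereal_sup_ubound.
split; last by move=> q [/ub//|->]; apply: int_resurgence_ge1.
have [[q0 Tq0 q01]|no] := pselect (exists2 q, int_ratios R I q & 1%:E < q); [left|right].
  have [q Tq qub] := int_ratios_max Tq0 q01.
  rewrite (_ : int_resurgence R I = q) //; apply/eqP; rewrite eq_le ub // andbT.
  exact: ub_ereal_sup.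
apply/eqP; rewrite eq_le int_resurgence_ge1 andbT; apply: ub_ereal_sup => q Tq.
by rewrite leNgt; apply/negP => q1; apply: no; exists q.
Qed.

Lemma int_resurgence_lt : I = int_closure I -> (1 < N)%N -> int_resurgence R I < (N%:R)%:E.
Proof.
move=> clI N1; have [[Tq|->] _] := int_resurgence_max; last by rewrite lte_fin ltr1n.
have [/idealr_closed_ideal[iI _] _] := hI.
move: Tq => [m [r [m0 r0 nc ->]]]; rewrite lte_fin ltr_pdivrMr ?ltr0n // -natrM ltr_nat.
rewrite ltnNge; apply/negP => Nrm; have mrN := int_ratio_bound nc.
have r1 : r = 1%N by apply/eqP; rewrite eqn_leq r0 andbT leqNgt; apply/negP => r1; nia.
apply: nc; rewrite r1 => c cI; apply: ideal_pow1; rewrite clI.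
apply: int_closure_sub cI => x /(ideal_pow_sub m0); exact: ideal_pow1_sub.
Qed.

End Resurgence.

Lemma sub_symb_pow (A : idomainType) (I : set A) m : ideal_pow I m `<=` symb_pow I m.
Proof.
move=> f If P [/idealr_closed_ideal[_ P1] _ _]; exists f, 1; split=> //.
by rewrite rmorph1 divr1.
Qed.

Lemma noncontainment_ratios_sub (R : realType) (A : comNzRingType)
    (J J' : nat -> set A) (I : set A) : (forall m, (1 <= m)%N -> J m `<=` J' m) ->
  noncontainment_ratios R J I `<=` noncontainment_ratios R J' I.
Proof.
move=> JJ q [m [r [m0 r0 nc ->]]]; exists m, r; split=> // nc'.
by apply: nc => x /(JJ m m0) /nc'.
Qed.

Lemma int_resurgence_le (R : realType) (A : idomainType) (I : set A) :
  (forall m, (1 <= m)%N -> symb_pow I m = int_closure (symb_pow I m)) ->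
  (int_resurgence R I <= resurgence R I)%E.
Proof.
move=> clS; apply: ereal_sup_le; apply: noncontainment_ratios_sub => m m1.
by rewrite clS //; apply: int_closure_sub; apply: sub_symb_pow.
Qed.

Lemma int_resurgence_eq (R : realType) (A : idomainType) (I : set A) :
  (forall m, (1 <= m)%N -> symb_pow I m = int_closure (ideal_pow I m)) ->
  int_resurgence R I = resurgence R I.
Proof.
move=> SE; congr ereal_sup.
by apply/seteqP; split; apply: noncontainment_ratios_sub => m /SE ->.
Qed.

(** * Fat points *)

Section XOrder.
Variable D : idomainType.
Implicit Types (x y : {poly D}).

Definition xord (k : nat) : set {poly D} :=
  [set x | forall j, (j < k)%N -> x`_j = 0].

Lemma xord0 x : xord 0 x.
Proof. by []. Qed.

Lemma xordP k x : xord k x <-> exists y, x = y * 'X^k.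
Proof.
split=> [xk|[y -> j jk]]; last by rewrite coefMXn jk.
exists (drop_poly k x); rewrite -[LHS](poly_take_drop k x).
rewrite (_ : take_poly k x = 0) ?add0r //; apply/polyP => j.
by rewrite coef_take_poly coef0; case: ifP => // /xk.
Qed.

Lemma xordM a b x y : xord a x -> xord b y -> xord (a + b) (x * y).
Proof.
move=> /xordP[x' ->] /xordP[y' ->]; apply/xordP; exists (x' * y').
by rewrite exprD mulrACA.
Qed.

Lemma coef_mul_xord a b x y :
  xord a x -> xord b y -> (x * y)`_(a + b) = x`_a * y`_b.
Proof.
move=> /xordP[x' ->] /xordP[y' ->]; rewrite mulrACA -exprD !coefMXn !ltnn !subnn.
by rewrite coefM big_ord1 subnn.
Qed.

Lemma xordX a x k : xord a x -> xord (a * k) (x ^+ k).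
Proof.
move=> xa; elim: k => [|k IH]; first by rewrite muln0.
by rewrite mulnS exprS; apply: xordM.
Qed.

Lemma coef_exp_xord a x k : xord a x -> (x ^+ k)`_(a * k) = x`_a ^+ k.
Proof.
move=> xa; elim: k => [|k IH]; first by rewrite muln0 !expr0 coef1.
by rewrite mulnS !exprS coef_mul_xord ?IH //; apply: xordX.
Qed.

Lemma xord_ideal k : is_ideal (xord k).
Proof.
split=> [j _|x y xk yk j jk|a x xk]; first by rewrite coef0.
  by rewrite coefD xk // yk // addr0.
by apply: (@xordM 0).
Qed.

Lemma not_xord k x : ~ xord k x -> exists e, [/\ (e < k)%N, xord e x & x`_e != 0].
Proof.
elim: k => [[]//|k IH nx]; have [xk|/IH[e [ek xe xe0]]] := pselect (xord k x).
  exists k; split=> //; apply: contra_notN nx => /eqP x0 j; rewrite ltnS leq_eqVlt.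
  by move=> /orP[/eqP ->|/xk].
by exists e; split=> //; apply: leqW.
Qed.

Lemma xord_integral k n (a : nat -> {poly D}) c : (0 < n)%N ->
    (forall j, (1 <= j <= n)%N -> xord (k * j) (a j)) ->
    c ^+ n + \sum_(1 <= j < n.+1) a j * c ^+ (n - j) = 0 ->
  xord k c.
Proof.
move=> n0 ak E; apply: contrapT => /not_xord[e [ek ce ce0]].
have /(congr1 (fun x : {poly D} => x`_(e * n))) := E.
rewrite coefD coef0 coef_exp_xord // coef_sum big_nat big1 ?addr0 => [/eqP|j jn].
  by rewrite expf_eq0 n0 (negPf ce0).
by apply: (xordM (ak j jn) (xordX (k := n - j) ce)); nia.
Qed.

End XOrder.

Section PointIdeal.
Variables (K : fieldType) (N : nat) (p : 'rV[K]_N.+1) (i0 : 'I_N.+1).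
Hypothesis p0 : p ord0 i0 != 0.

Let PI := point_ideal p.
Let q i := p ord0 i / p ord0 i0.
Let lin i : {mpoly K[N.+1]} := 'X_i - q i *: 'X_i0.

(* The substitution x_i |-> q_i x_i0 + T (x_i - q_i x_i0), under which the order
   in T measures the order of vanishing at p. *)
Definition spread (i : 'I_N.+1) : {poly {mpoly K[N.+1]}} :=
  (q i *: 'X_i0)%:P + (lin i)%:P * 'X.

Definition point_blowup : {rmorphism {mpoly K[N.+1]} -> {poly {mpoly K[N.+1]}}} :=
  mmap (polyC \o @mpolyC N.+1 K) spread.

Let blowup0 : point_blowup 0 = 0.
Proof. exact: rmorph0. Qed.

Let blowupD f g : point_blowup (f + g) = point_blowup f + point_blowup g.
Proof. exact: rmorphD. Qed.

Let blowupM f g : point_blowup (f * g) = point_blowup f * point_blowup g.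
Proof. exact: rmorphM. Qed.

Lemma horner1_blowup f : (point_blowup f).[1] = f.
Proof.
rewrite /point_blowup /mmap horner_sum [RHS]mpolyE; apply: eq_bigr => m _.
rewrite hornerM /= hornerC mul_mpolyC; congr (_ *: _).
rewrite /mmap1 horner_prod mpolyXE_id; apply: eq_bigr => i _.
by rewrite horner_exp /spread hornerD hornerCM hornerX hornerC mulr1 addrC subrK.
Qed.

Lemma lin_point_ideal i : PI (lin i).
Proof.
apply: sub_ideal_gen; split.
  exists 1%N; apply: rpredB; last apply: rpredZ; rewrite dhomogX; exact/eqP/mdeg1.
by rewrite mevalB mevalZ !mevalXU /q divfK ?subrr.
Qed.

Let rees : set {poly {mpoly K[N.+1]}} := [set g | forall j, ideal_pow PI j g`_j].

Let reesM g h : rees g -> rees h -> rees (g * h).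
Proof.
move=> rg rh j; rewrite coefM; apply: is_ideal_sum => [|i _]; first exact: ideal_pow_ideal.
by rewrite -{1}(subnKC (ltn_ord i : (i <= j)%N)); apply: ideal_powM.
Qed.

Let reesC c : rees c%:P.
Proof.
move=> j; rewrite coefC; case: eqP => [->|_]; first exact: ideal_pow0.
exact: is_ideal0 (ideal_pow_ideal _ _).
Qed.

Lemma blowup_coef f j : ideal_pow PI j (point_blowup f)`_j.
Proof.
suff : rees (point_blowup f) by apply.
have reesD g h : rees g -> rees h -> rees (g + h).
  by move=> rg rh k; rewrite coefD; case: (ideal_pow_ideal PI k) => _ + _; apply.
have rees0 : rees 0 by rewrite -polyC0; apply: reesC.
rewrite /point_blowup /mmap; apply: (big_ind rees) => // m _.
apply: reesM; first exact: reesC.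
have rees1 : rees 1 by rewrite -polyC1; apply: reesC.
rewrite /mmap1; elim/big_ind: _ => [|g h|i _]; [exact: rees1 | exact: reesM|].
have rs : rees (spread i).
  move=> [|[|k]]; first exact: ideal_pow0.
    rewrite /spread coefD coefC coefCM coefX /= add0r mulr1.
    exact/ideal_pow1/lin_point_ideal.
  rewrite /spread coefD coefC coefCM coefX /= add0r mulr0.
  exact: is_ideal0 (ideal_pow_ideal _ _).
elim: (m i) => [|k IH]; first by rewrite expr0.
by rewrite exprS; apply: reesM.
Qed.

Lemma blowup_point_ideal f : PI f -> xord 1 (point_blowup f).
Proof.
have [X0 XD XM] := xord_ideal {mpoly K[N.+1]} 1.
move: f; apply: (ideal_gen_min (T := [set f | xord 1 (point_blowup f)])).
  split=> [|x y xT yT|a x xT].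
  - rewrite /mkset blowup0; exact: X0.
  - rewrite /mkset blowupD; exact: (XD _ _ xT yT).
  - rewrite /mkset blowupM; exact: (XM _ _ xT).
move=> f [[d fd] fp] [|//] _; rewrite -horner_coef0 /point_blowup /mmap horner_sum.
have E0 : (p ord0 i0 ^- d * f.@[p ord0])%:MP * 'X_i0 ^+ d = 0 :> {mpoly K[N.+1]}.
  by rewrite fp mulr0 mpolyC0 mul0r.
rewrite -[RHS]E0 mevalE mulr_sumr raddf_sum mulr_suml big_seq [RHS]big_seq.
apply: eq_bigr => m mf /=; rewrite hornerM hornerC /mmap1 horner_prod.
have md : d = (\sum_i m i)%N by rewrite -mdegE (dhomog_mf fd mf).
have qE : \prod_i q i ^+ m i = p ord0 i0 ^- d * \prod_i p ord0 i ^+ m i.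
  under eq_bigr => i _ do rewrite /q exprMn.
  by rewrite big_split /= -expr_sum -md exprVn mulrC.
under eq_bigr => i _ do rewrite horner_exp /spread hornerD hornerCM hornerX hornerC
  mulr0 addr0 -mul_mpolyC exprMn -rmorphXn.
rewrite big_split /= -expr_sum -md -rmorph_prod /= qE.
by rewrite mulrA -mpolyCM mulrCA.
Qed.


Lemma point_ideal_powP k f : ideal_pow PI k f <-> xord k (point_blowup f).
Proof.
split=> [|fk].
  elim: k f => [|k IH] // f; have [X0 XD XM] := xord_ideal {mpoly K[N.+1]} k.+1.
  apply: (ideal_powS_min (T := [set f | xord k.+1 (point_blowup f)])).
    split=> [|x y xT yT|a x xT].
    - rewrite /mkset blowup0; exact: X0.
    - rewrite /mkset blowupD; exact: (XD _ _ xT yT).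
    - rewrite /mkset blowupM; exact: (XM _ _ xT).
  move=> x y Px /IH yk; rewrite /mkset blowupM.
  exact: (xordM (a := 1) (blowup_point_ideal Px) yk).
rewrite -(horner1_blowup f) horner_coef.
apply: is_ideal_sum => [|j _]; first exact: ideal_pow_ideal.
rewrite expr1n mulr1; have [kj|jk] := leqP k j.
  exact: ideal_pow_sub kj _ (blowup_coef f j).
by rewrite fk //; apply: is_ideal0 (ideal_pow_ideal _ _).
Qed.

Lemma point_ideal_integral_aux k :
  int_closure (ideal_pow PI k) `<=` ideal_pow PI k.
Proof.
move=> c [n [a [n0 ak E]]]; apply/point_ideal_powP.
apply: (xord_integral (a := fun j => point_blowup (a j)) n0) => [j jn|].
  by apply/point_ideal_powP; rewrite -ideal_pow_powE; apply: ak.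
rewrite -[RHS]blowup0 -[in RHS]E blowupD rmorphXn; congr (_ + _); rewrite rmorph_sum.
by apply: eq_bigr => j _; rewrite blowupM rmorphXn.
Qed.

Lemma point_ideal_primary_aux k s f :
  ~ PI s -> ideal_pow PI k (s * f) -> ideal_pow PI k f.
Proof.
move=> ns /point_ideal_powP sfk; apply/point_ideal_powP.
apply: contrapT => /not_xord[e [ek fe fe0]].
have s0 : (point_blowup s)`_0 != 0.
  apply: contra_notN ns => /eqP s0; apply: ideal_pow1_sub; first exact: ideal_gen_ideal.
  by apply/point_ideal_powP => -[].
have E : (point_blowup s * point_blowup f)`_(0 + e) = 0.
  by have := sfk e ek; rewrite blowupM.
have /eqP := etrans (esym (coef_mul_xord (xord0 (point_blowup s)) fe)) E.
by rewrite mulf_eq0 (negPf s0) (negPf fe0).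
Qed.

Lemma point_ideal_proper_aux : ~ PI 1.
Proof.
move=> /ideal_pow1/point_ideal_powP/(_ 0%N isT)/eqP.
by rewrite rmorph1 coef1 oner_eq0.
Qed.

Lemma point_ideal_sub_aux (p' : 'rV[K]_N.+1) :
  (forall f, PI f -> f.@[p' ord0] = 0) -> p' = (p' ord0 i0 / p ord0 i0) *: p.
Proof.
move=> p'0; apply/rowP => i; have := p'0 _ (lin_point_ideal i).
rewrite mevalB mevalZ !mevalXU => /eqP; rewrite subr_eq0 => /eqP ->.
by rewrite !mxE mulrC mulrA mulrAC.
Qed.

End PointIdeal.

Section PointIdeals.
Variables (K : fieldType) (N : nat).
Implicit Types (p : 'rV[K]_N.+1).

Let nz_coord p : p != 0 -> exists i, p ord0 i != 0.
Proof.
move=> p0; apply/existsP; apply: contraNT p0; rewrite negb_exists => /forallP H.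
by apply/eqP/rowP => i; rewrite mxE; apply/eqP; have := H i; rewrite negbK.
Qed.

Lemma point_ideal_integral p k : p != 0 ->
  int_closure (ideal_pow (point_ideal p) k) `<=` ideal_pow (point_ideal p) k.
Proof. by move=> /nz_coord[i pi]; apply: point_ideal_integral_aux pi k. Qed.

Lemma point_ideal_primary p k s f : p != 0 -> ~ point_ideal p s ->
  ideal_pow (point_ideal p) k (s * f) -> ideal_pow (point_ideal p) k f.
Proof. by move=> /nz_coord[i pi]; apply: point_ideal_primary_aux pi k s f. Qed.

Lemma point_ideal_mul_notin p x y : p != 0 ->
  ~ point_ideal p x -> ~ point_ideal p y -> ~ point_ideal p (x * y).
Proof.
move=> p0 nx ny /ideal_pow1/(point_ideal_primary p0 nx) H.
by apply: ny; apply: ideal_pow1_sub H; apply: ideal_gen_ideal.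
Qed.

Lemma point_ideal_proper p : p != 0 -> ~ point_ideal p 1.
Proof. by move=> /nz_coord[i pi]; apply: point_ideal_proper_aux pi. Qed.

Lemma point_ideal_meval p f : point_ideal p f -> f.@[p ord0] = 0.
Proof.
move: f; apply: (ideal_gen_min (T := [set f | f.@[p ord0] = 0])) => [|f [_ fp] //].
split=> [|x y /= x0 y0|a x /= x0]; rewrite /mkset; first exact: meval0.
  by rewrite mevalD x0 y0 addr0.
by rewrite mevalM x0 mulr0.
Qed.

Lemma point_ideal_notsub p p' : p != 0 -> (forall c : K, p' != c *: p) ->
  exists2 f, point_ideal p f & ~ point_ideal p' f.
Proof.
move=> /nz_coord[i pi] np; apply: contrapT => nf.
have := np (p' ord0 i / p ord0 i); rewrite {1}(point_ideal_sub_aux pi (p' := p')) ?eqxx //.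
move=> f Pf; apply: point_ideal_meval; apply: contrapT => nPf.
by apply: nf; exists f.
Qed.

End PointIdeals.

Section FatPoints.
Variables (K : fieldType) (N s : nat) (p : 'I_s -> 'rV[K]_N.+1) (mult : 'I_s -> nat).
Hypothesis dp : distinct_points p.

Let P i := point_ideal (p i).
Let I := fat_point_ideal p mult.

Let p0 i : p i != 0.
Proof. by case: dp. Qed.

Lemma fat_point_prod (x : 'I_s -> {mpoly K[N.+1]}) :
  (forall i, P i (x i)) -> I (\prod_i x i ^+ mult i).
Proof.
move=> Px i _; rewrite (bigD1 i) //=; apply: is_idealMr; first exact: ideal_pow_ideal.
exact: ideal_powX (Px i).
Qed.

Lemma ass_fat_point Q : ass_primes I Q -> exists i, Q = P i.
Proof.
move=> [Qi Qp [g Qg]]; have [_ Q1] := idealr_closed_ideal Qi.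
have [i gi] : exists i, ~ ideal_pow (P i) (mult i) g.
  apply: contrapT => ng; apply: Q1; rewrite Qg /mkset mul1r => i _.
  by apply: contrapT => gi; apply: ng; exists i.
have QP : Q `<=` P i.
  move=> x; rewrite Qg => /(_ i Logic.I) xg; apply: contrapT => nx.
  exact: gi (point_ideal_primary (p0 i) nx xg).
have [j PQ] : exists j, P j `<=` Q.
  apply: contrapT => nj.
  have ex j : exists x, P j x /\ ~ Q x.
    apply: contrapT => nx; apply: nj; exists j => x Px.
    by apply: contrapT => nQ; apply: nx; exists x.
  have [x Hx] := choice ex.
  have QM u v : ~ Q u -> ~ Q v -> ~ Q (u * v).
    by move=> nu nv /mem_set/Qp/orP[/set_mem|/set_mem].
  suff nQ : ~ Q (\prod_i x i ^+ mult i).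
    apply: nQ; rewrite Qg => k _; rewrite mulrC.
    have [_ _ IM] := ideal_pow_ideal (P k) (mult k).
    by apply: IM; apply: fat_point_prod => // l; case: (Hx l).
  elim/big_ind: _ => [//|u v nu nv|k _]; first exact: QM.
  elim: (mult k) => [|d IH]; first by rewrite expr0.
  by rewrite exprS; apply: QM => //; case: (Hx k).
suff ji : j = i by exists i; apply/seteqP; split=> //; rewrite -ji.
apply/eqP; apply: contrapT => /negP nji; have [_ dist] := dp.
have nij : i != j by rewrite eq_sym.
have [f Pf] := point_ideal_notsub (p0 j) (dist i j nij).
by apply; apply: QP; apply: PQ.
Qed.

Lemma symb_pow_fat_point m :
  symb_pow I m = int_closure (symb_pow I m).
Proof.
apply/seteqP; split; first exact: sub_int_closure.
move=> f fcl Q QA; have [i QE] := ass_fat_point QA; rewrite QE.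
have nP1 : forall x, ~ P i x -> x != 0.
  by move=> x nx; apply: contra_notN nx => /eqP ->; apply: is_ideal0 (ideal_gen_ideal _).
have SP : symb_pow I m `<=` ideal_pow (P i) (mult i * m).
  move=> x /(_ Q QA)[a [t [Ia]]]; rewrite QE => nt E.
  have t0 : tofrac t != 0 by rewrite tofrac_eq0 nP1.
  have {}E : t * x = a.
    by apply/eqP; rewrite -tofrac_eq tofracM E mulrC divfK.
  apply: (point_ideal_primary (p0 i) nt); rewrite E -ideal_pow_powE.
  by apply: ideal_powS_set Ia => y /(_ i Logic.I).
have fP : ideal_pow (ideal_pow (P i) (mult i)) m f.
  rewrite ideal_pow_powE; apply: point_ideal_integral (p0 i) _ _.
  exact: int_closure_sub SP _ fcl.
have ex j : exists x, (j != i -> P j x) /\ ~ P i x.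
  have [->|ji] := eqVneq j i; first by exists 1; split=> //; apply: point_ideal_proper.
  have [_ dist] := dp; have ij : i != j by rewrite eq_sym.
  have [x Px nx] := point_ideal_notsub (p0 j) (dist i j ij).
  by exists x; split.
have [x Hx] := choice ex; pose t := \prod_(j | j != i) x j ^+ mult j.
have nmul u v : ~ P i u -> ~ P i v -> ~ P i (u * v) by apply: point_ideal_mul_notin.
have nX u d : ~ P i u -> ~ P i (u ^+ d).
  move=> nu; elim: d => [|d IH]; first by rewrite expr0; apply: point_ideal_proper.
  by rewrite exprS; apply: nmul.
have nt : ~ P i t.
  rewrite /t; elim/big_ind: _ => [|u v nu nv|j _]; first exact: point_ideal_proper.
    exact: nmul.
  by apply: nX; case: (Hx j).
have tI y : ideal_pow (P i) (mult i) y -> I (t * y).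
  move=> Py j _; have iPj := ideal_pow_ideal (P j) (mult j).
  have [->|ji] := eqVneq j i; first by case: (ideal_pow_ideal (P i) (mult i)) => _ _; apply.
  rewrite /t (bigD1 j) //= -mulrA; apply: is_idealMr => //.
  by apply: ideal_powX; case: (Hx j) => + _; apply.
have tmI : ideal_pow I m (t ^+ m * f).
  move: f fP {fcl}; apply: (ideal_pow_min (is_ideal_colon _ (ideal_pow_ideal _ _))) => g Pg.
  rewrite /mkset -[X in t ^+ X]card_ord -prodr_const -big_split.
  by apply: ideal_pow_prod => k; apply: tI.
have ntm : ~ P i (t ^+ m) by apply: nX.
exists (t ^+ m * f), (t ^+ m); split=> //.
by rewrite tofracM mulrC mulKf // tofrac_eq0 nP1.
Qed.

End FatPoints.

Unset Implicit Arguments.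

Theorem theorem2p7 (R : realType) (K : fieldType) (N : nat) (hN : (1 <= N)%N) :
  (forall I : set {mpoly K[N.+1]},
     proper_homog_ideal I -> I <> [set 0] ->
     [/\ (* (a) *)
         (1%:E <= int_resurgence R I)%E /\
         is_maximum (int_ratios R I `|` [set 1%:E]) (int_resurgence R I),
         (* (b) *)
         I = int_closure I -> (1 < N)%N ->
         (int_resurgence R I < (N%:R)%:E)%E,
         (* (c) *)
         (forall m, (1 <= m)%N -> symb_pow I m = int_closure (symb_pow I m)) ->
         (int_resurgence R I <= resurgence R I)%E &
         (* (d) *)
         (forall m, (1 <= m)%N -> symb_pow I m = int_closure (ideal_pow I m)) ->
         int_resurgence R I = resurgence R I]) /\
  (* the example in (c) *)
  (forall (s : nat) (p : 'I_s -> 'rV[K]_N.+1) (mult : 'I_s -> nat),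
     distinct_points p -> (exists i, mult i != 0%N) ->
     forall m, (1 <= m)%N ->
       symb_pow (fat_point_ideal p mult) m =
       int_closure (symb_pow (fat_point_ideal p mult) m)).
Proof.
split=> [I hI I0|s p mult dp _ m _]; last exact: symb_pow_fat_point.
split.
- by split; [apply: int_resurgence_ge1 | apply: int_resurgence_max].
- exact: int_resurgence_lt.
- exact: int_resurgence_le.
- exact: int_resurgence_eq.
Qed.
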